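(* Suppose the angular rank is uniform: $|\mathcal V_{\delta,C}|=4r$ for all $C\in\mathcal C$, with $|\mathcal V_{\delta,C,\mathfrak i}|=r$ for each of the four edges $\mathfrak i$ of $C$. Then the derivation of the explicit multilevel decomposition of the solution operator $B_\delta^{-1}=(B_\delta^{(0)})^{-1}$ (i.e. the computation of the matrices $B_\delta^{(l)}$, $0\le l\le L$, of $P_\delta^{(l)},Q_\delta^{(l)},R_\delta^{(l)},\check R_\delta^{(l)}$, $0\le l\le L-1$, and of $(B_\delta^{(L)})^{-1}$) incurs a total computational cost of $O(r^3I^3)$ arithmetic operations.
   Context: **Mesh hierarchy.** $\Omega=[0,1]^2$ is divided uniformly into $I\times I$ square cells of width $h=1/I$ (level $0$), $I=2^L I^{(L)}$, with $I^{(L)}=O(1)$ (so $L\sim\log_2 I$). For $0\le l\le L$, $\mathcal C^{(l)}$ is the set of cells of the uniform $I^{(l)}\times I^{(l)}$ mesh, $I^{(l)}=I/2^l$, so each cell of $\mathcal C^{(l)}$ is a union of $2\times2$ cells of $\mathcal C^{(l-1)}$. $\mathcal C=\mathcal C^{(0)}$. $\mathcal I=\mathcal I^{(0)}$ is the set of edges (interfaces) of level-$0$ cells; $\mathcal I^{(l)}\subset\mathcal I$ is the set of those level-$0$ edges lying on the boundary of some cell of $\mathcal C^{(l)}$. $\mathcal I_{\mathrm b}^{(l)}$ and $\mathcal I_{\mathrm{in}}^{(l)}$ are the edges of $\mathcal I^{(l)}$ lying on $\partial\Omega$, respectively in the interior of $\Omega$; $\mathcal I_{\mathrm b}=\mathcal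 I_{\mathrm b}^{(0)}$, $\mathcal I_{\mathrm{in}}=\mathcal I_{\mathrm{in}}^{(0)}$. Thus $\mathcal I^{(l)}\subset\mathcal I^{(l-1)}$, $\mathcal I_{\mathrm b}^{(l)}=\mathcal I_{\mathrm b}$. $\bar{\mathbf x}_{\mathfrak i}$ is the midpoint of $\mathfrak i$, $\bar{\mathbf x}_C$ the center of $C$; for a set $\mathcal S$ of edges, $\mathcal S\cap C$ denotes the edges of $\mathcal S$ contained in $C$. **Local basis functions.** Let $(c_m,s_m,\omega_m)_{m=1}^{4M}$ be a discrete ordinate set ($M$ directions in each quadrant, $c_m,s_m\ne0$), $K=(\kappa_{m,p})$ the discrete scattering matrix, $W=\mathrm{diag}(\omega_m)$, $D=\mathrm{diag}(c_m)$, $S=\mathrm{diag}(s_m)$. For $C\in\mathcal C$ let $\sigma_{T,C}$, $\sigma_{s,C}$ be the (constant, scaled) total and scattering cross sections on $C$, i.e. $\bar\sigma_T/\epsilon$ and $\bar\sigma_T/\epsilon-\epsilon\bar\sigma_a$ with cell averages $\bar\sigma_T,\bar\sigma_a$. Let $(\lambda_C^{(k)},\xi_C^{(k)})$, $1\le k\le4M$, be the eigenpairs of $D^{-1}[\frac{\sigma_{s,C}}{\sigma_{T,C}}KW-\mathrm{Id}]$ and, for $4M+1\le k\le8M$, those of $S^{-1}[\frac{\sigma_{s,C}}{\sigma_{T,C}}KW-\mathrm{Id}]$, with $\|\xi_C^{(k)}\|_\infty=1$, the negative eigenvalues being those with $1\le k\le2M$ and $4M+1\le k\le6M$. On $C$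 put $\phi_C^k(x,y)=\xi_C^{(k)}\exp(\lambda_C^{(k)}\sigma_{T,C}(x-x_C^{(k)}))$ for $k\le4M$, where $x_C^{(k)}$ is the abscissa of the left side of $C$ for $k\le2M$ and of the right side for $k>2M$; and $\phi_C^k(x,y)=\xi_C^{(k)}\exp(\lambda_C^{(k)}\sigma_{T,C}(y-y_C^{(k)}))$ for $k>4M$, where $y_C^{(k)}$ is the ordinate of the bottom side for $k\le6M$ and of the top side for $k>6M$. $\phi_C^k$ is extended by $0$ to the other cells. $\mathcal V_{C,\mathfrak i}$ is the set of the $2M$ indices $k$ for which $\phi_C^k$ is centered on the edge $\mathfrak i$ of $C$. **Selected indices.** For a threshold $\delta>0$: $\mathcal V_{\delta,C}=\{k\in\{1,\dots,8M\}:|\phi_C^k(\bar{\mathbf x}_C)|>\delta\}$ ($|\cdot|$ the sup norm), $\mathcal V_{\delta,C,\mathfrak i}=\mathcal V_{\delta,C}\cap\mathcal V_{C,\mathfrak i}$ for $C\in\mathcal C$, and $\mathcal V_{\delta,\mathfrak i}=\bigcup_{C\in\mathcal C,\ \mathfrak i\subset C}\mathcal V_{\delta,C,\mathfrak i}$ (a disjoint union). For $C\in\mathcal C^{(l)}$ put $\mathcal V_{\delta,C,\mathfrak i}=\bigcup_{C_0\in\mathcal C,\ C_0\subset C}\mathcal V_{\delta,C_0,\mathfrak i}$ (over $C_0$ having $\mathfrak i$ as edge). $\mathcal F_\delta$ is the real span of all $\phi_C^k$, $C\in\mathcal C$, $k\in\mathcal V_{\delta,C}$; its elements are piecewise functions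 with one $\mathbb R^{4M}$-valued smooth function on each level-$0$ cell. For a cell $C$ of any level and an edge $\mathfrak i\subset\partial C$, $f(\bar{\mathbf x}_{\mathfrak i})|_C$ is the one-sided value from inside $C$; $[f(\bar{\mathbf x}_{\mathfrak i})]$ is the jump across $\mathfrak i\in\mathcal I_{\mathrm{in}}$ (with a fixed orientation of each edge). **Projections.** For $\mathfrak i\in\mathcal I_{\mathrm{in}}$ the $4M$ vectors $\xi_C^{(k)}$ ($C\in\mathcal C$ adjacent to $\mathfrak i$, $k\in\mathcal V_{C,\mathfrak i}$) form a basis of $\mathbb R^{4M}$. Orthogonalize those with $k\in\mathcal V_{\delta,C,\mathfrak i}$ by QR, giving $(\chi_{\mathfrak i}^{(k)})_{k\in\mathcal V_{\delta,\mathfrak i}}$, and let the remaining $\chi_{\mathfrak i}^{(k)}$ be the unselected $\xi_C^{(k)}$; all normalized to sup norm $1$. For $v\in\mathbb R^{4M}$, $\mathcal P_{\delta,\mathfrak i}^k v$ is the coefficient of $\chi_{\mathfrak i}^{(k)}$ in the expansion of $v$ in the basis $(\chi_{\mathfrak i}^{(k)})$. For $\mathfrak i\in\mathcal I_{\mathrm b}$, $\mathcal P_{\delta,\mathfrak i}^k$ is defined in the same way on $\mathbb R^{2M}$, using only the $2M$ inflow components (those $m$ with $\mathbf n\cdot(c_m,s_m)<0$, $\mathbf n$ the outward normal) of all vectors. **Solution spaces.** $\mathcal F_\delta^{(0)}=\mathcal F_\delta$ and, for $1\le l\le L$, $$\mathcal F_\delta^{(l)}=\{f\in\mathcal F_\delta^{(l-1)}:\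 \mathcal P_{\delta,\mathfrak i}^k[f(\bar{\mathbf x}_{\mathfrak i})]=0\ \ \forall\mathfrak i\in\mathcal I_{\mathrm{in}}^{(l-1)}\setminus\mathcal I_{\mathrm{in}}^{(l)},\ \forall k\in\mathcal V_{\delta,\mathfrak i}\},$$ $$\mathcal G_\delta^{(l)}=\{f\in\mathcal F_\delta^{(l-1)}:\ \mathcal P_{\delta,\mathfrak i}^k(f(\bar{\mathbf x}_{\mathfrak i})|_C)=0\ \ \forall C\in\mathcal C^{(l)},\ \forall\mathfrak i\in\mathcal I^{(l)}\cap C,\ \forall k\in\mathcal V_{\delta,C,\mathfrak i}\}.$$ **Standing assumption (unique solvability).** (i) For $0\le l\le L$, an element of $\mathcal F_\delta^{(l)}$ exists and is unique for each prescribed family of values $\mathcal P_{\delta,\mathfrak i}^k(f(\bar{\mathbf x}_{\mathfrak i})|_C)$, $C\in\mathcal C^{(l)}$, $\mathfrak i\in\mathcal I^{(l)}\cap C$, $k\in\mathcal V_{\delta,C,\mathfrak i}$. (ii) For $1\le l\le L$, an element of $\mathcal G_\delta^{(l)}$ exists and is unique for each prescribed family of values $\mathcal P_{\delta,\mathfrak i}^k[f(\bar{\mathbf x}_{\mathfrak i})]$, $\mathfrak i\in\mathcal I^{(l-1)}\setminus\mathcal I^{(l)}$, $k\in\mathcal V_{\delta,\mathfrak i}$. **Data vectors.** For $f\in\mathcal F_\delta$: $\mathbf f_{\mathcal C^{(l)}}=\big(\mathcal P_{\delta,\mathfrak i}^k(f(\bar{\mathbf x}_{\mathfrak i})|_C)\big)_{C\in\mathcal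 C^{(l)},\,\mathfrak i\in\mathcal I\cap\partial C,\,k\in\mathcal V_{\delta,C,\mathfrak i}}$; $\mathbf f_{\mathcal C^{(l)},\mathrm b}$ is its subvector with $\mathfrak i\in\mathcal I_{\mathrm b}$; for $\mathcal I_{\mathrm{sub}}\subseteq\mathcal I_{\mathrm{in}}$, $[\mathbf f]_{\mathcal I_{\mathrm{sub}}}=\big(\mathcal P_{\delta,\mathfrak i}^k[f(\bar{\mathbf x}_{\mathfrak i})]\big)_{\mathfrak i\in\mathcal I_{\mathrm{sub}},\,k\in\mathcal V_{\delta,\mathfrak i}}$. **Operators (linear maps).** - $B_\delta^{(l)}$ ($0\le l\le L$): $\mathbf f_{\mathcal C^{(l)}}\mapsto(\mathbf f_{\mathcal C^{(l)},\mathrm b}^T,[\mathbf f]_{\mathcal I_{\mathrm{in}}^{(l)}}^T)^T$ for $f\in\mathcal F_\delta^{(l)}$. It is assumed throughout that $B_\delta^{(l)}$ is a bijection for every $l$. - $P_\delta^{(l)}$ ($0\le l\le L-1$): $\mathbf f_{\mathcal C^{(l+1)}}\mapsto\mathbf f_{\mathcal C^{(l)}}$ for $f\in\mathcal F_\delta^{(l+1)}$. - $Q_\delta^{(l)}$ ($0\le l\le L-1$): $[\mathbf f]_{\mathcal I^{(l)}\setminus\mathcal I^{(l+1)}}\mapsto\mathbf f_{\mathcal C^{(l)}}$ for $f\in\mathcal G_\delta^{(l+1)}$. - $R_\delta^{(l)}$, $\check R_\delta^{(l)}$ ($0\le l\le L-1$): for $f\in\mathcal F_\delta^{(l)}$ they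 map $(\mathbf f_{\mathcal C^{(l)},\mathrm b}^T,[\mathbf f]_{\mathcal I_{\mathrm{in}}^{(l)}}^T)^T$ to $(\mathbf f_{\mathcal C^{(l+1)},\mathrm b}^T,[\mathbf f]_{\mathcal I_{\mathrm{in}}^{(l+1)}}^T)^T$ and to $[\mathbf f]_{\mathcal I_{\mathrm{in}}^{(l)}\setminus\mathcal I_{\mathrm{in}}^{(l+1)}}$, respectively (both are $0$–$1$ selection matrices). **Multilevel decomposition.** The representation of $B_\delta^{-1}=(B_\delta^{(0)})^{-1}$ obtained by recursively using, for $l=0,\dots,L-1$, $(B_\delta^{(l)})^{-1}=P_\delta^{(l)}(B_\delta^{(l+1)})^{-1}(R_\delta^{(l)}-R_\delta^{(l)}B_\delta^{(l)}Q_\delta^{(l)}\check R_\delta^{(l)})+Q_\delta^{(l)}\check R_\delta^{(l)}$, with $(B_\delta^{(L)})^{-1}$ stored explicitly. **Cost convention.** Costs are sequential counts of arithmetic operations, with classical (cubic) dense linear algebra, starting from the projected values $\mathcal P_{\delta,\mathfrak i}^{k'}(\phi_C^k(\bar{\mathbf x}_{\mathfrak i})|_C)$ ($C\in\mathcal C$, $k\in\mathcal V_{\delta,C}$, $\mathfrak i$ an edge of $C$, $k'\in\mathcal V_{\delta,\mathfrak i}$) of the finest-level local functions; the $O$-constant is independent of $r$ and $I$. *)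

(* Defs.v *)
From mathcomp Require Import all_boot all_order all_algebra.
From mathcomp Require Import all_classical all_reals all_analysis.
Set Implicit Arguments.
Unset Strict Implicit.
Unset Printing Implicit Defensive.
Import Order.TTheory GRing.Theory Num.Theory.
Import numFieldNormedType.Exports.
Local Open Scope ring_scope.

(** * Mesh hierarchy

    [N] is the number of level-0 cells per direction.
    An axis is a boolean: [false] for x, [true] for y.  A side of a cell is
    (axis of its normal, is it the upper one?):
    (false,false) left, (false,true) right, (true,false) bottom, (true,true) top. *)
Definition side : Type := (bool * bool)%type.

Definition cell (N l : nat) : Type := ('I_(N %/ 2 ^ l) * 'I_(N %/ 2 ^ l))%type.

(** The level-0 edge (a, p, q) has its normal along the axis [a]; it lies on the
    line of abscissa (ordinate if [a]) p/N and spans [q/N, (q+1)/N] along the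
    other axis. *)
Definition edge (N : nat) : Type := (bool * 'I_N.+1 * 'I_N)%type.

Definition eaxis N (i : edge N) : bool := i.1.1.
Definition epos N (i : edge N) : nat := i.1.2.
Definition etan N (i : edge N) : nat := i.2.

Definition pos N l (C : cell N l) (a : bool) : nat := if a then C.2 else C.1.

(** The level-0 cell [C0] is contained in the level-l cell [C]. *)
Definition subcell N l (C0 : cell N 0) (C : cell N l) : bool :=
  (C0.1 %/ 2 ^ l == C.1 :> nat)%N && (C0.2 %/ 2 ^ l == C.2 :> nat)%N.

(** The level-0 edge [i] is contained in the side [s] of the level-l cell [C]. *)
Definition on_side N l (C : cell N l) (s : side) (i : edge N) : bool :=
  [&& eaxis i == s.1,
      epos i == ((pos C s.1 + s.2) * 2 ^ l)%N
    & (pos C (~~ s.1) * 2 ^ l <= etan i < (pos C (~~ s.1)).+1 * 2 ^ l)%N].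

(** The level-0 edge [i] is contained in the boundary of the level-l cell [C];
    for [i] in the l-th skeleton this is the same as being contained in [C]. *)
Definition on_bd N l (C : cell N l) (i : edge N) : bool :=
  [exists s : side, on_side C s i].

Definition skel (N l : nat) : {set edge N} :=
  [set i | [exists C : cell N l, on_bd C i]].
Definition bnd (N : nat) : {set edge N} :=
  [set i | (epos i == 0%N) || (epos i == N)].
Definition inner (N l : nat) : {set edge N} := skel N l :\: bnd N.

(** * Indices of local basis functions

    The index k in {1, ..., 8M} is encoded as a pair (s, j) of the side [s] on
    which the basis function is centered and of [j : 'I_(2 * M)]:
    k = 2M * rank(s) + j + 1 with the sides ranked left, right, bottom, top. *)
Definition idx (M : nat) : Type := (side * 'I_(2 * M))%type.

(** A selection of indices in each level-0 cell (the sets V_{delta,C}). *)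
Definition selection (N M : nat) : Type := cell N 0 -> {set idx M}.

(** V_{delta,C,i}, for a cell [C] of any level. *)
Definition selC N M (V : selection N M) l (C : cell N l) (i : edge N) :
    {set idx M} :=
  \bigcup_(C0 : cell N 0 | subcell C0 C) [set k in V C0 | on_side C0 k.1 i].

(** V_{delta,i}; the indices coming from the two neighbours are disjoint, since
    their first components are opposite sides. *)
Definition selE N M (V : selection N M) (i : edge N) : {set idx M} :=
  \bigcup_(C0 : cell N 0 | on_bd C0 i) selC V C0 i.

(** * Index sets of the data vectors *)
Definition dofT N M (V : selection N M) l : finType :=
  {x : cell N l * edge N * idx M |
    on_bd x.1.1 x.1.2 && (x.2 \in selC V x.1.1 x.1.2)}.
Definition bdofT N M (V : selection N M) l : finType :=
  {x : cell N l * edge N * idx M |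
    [&& on_bd x.1.1 x.1.2, x.1.2 \in bnd N & x.2 \in selC V x.1.1 x.1.2]}.
Definition jumpT N M (V : selection N M) (S : {set edge N}) : finType :=
  {x : edge N * idx M | (x.1 \in S) && (x.2 \in selE V x.1)}.
Definition rhsT N M (V : selection N M) l : finType :=
  (bdofT V l + jumpT V (inner N l))%type.

(** * Continuous data *)

(** [qc], [qs], [qw] are the ordinates c_m, s_m and the weights omega_m; [sigT],
    [sigA] are the unscaled cell averages; [chi i k] is the (orthogonalized)
    basis vector attached to the edge [i]. *)
Record tfpm (R : realType) (N M : nat) := Tfpm {
  qc : 'I_(4 * M) -> R;
  qs : 'I_(4 * M) -> R;
  qw : 'I_(4 * M) -> R;
  kap : 'M[R]_(4 * M);
  eps : R;
  sigT : cell N 0 -> R;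
  sigA : cell N 0 -> R;
  lam : cell N 0 -> idx M -> R;
  xi : cell N 0 -> idx M -> 'cV[R]_(4 * M);
  chi : edge N -> idx M -> 'cV[R]_(4 * M)
}.

Definition sT R N M (d : tfpm R N M) (C : cell N 0) : R := sigT d C / eps d.
Definition sS R N M (d : tfpm R N M) (C : cell N 0) : R :=
  sigT d C / eps d - eps d * sigA d C.

(** c_m or s_m, according to the axis. *)
Definition qdir R N M (d : tfpm R N M) (a : bool) : 'I_(4 * M) -> R :=
  if a then qs d else qc d.

Definition transport R N M (d : tfpm R N M) (C : cell N 0) (a : bool) :
    'M[R]_(4 * M) :=
  invmx (diag_mx (\row_m qdir d a m)) *m
  ((sS d C / sT d C) *: (kap d *m diag_mx (\row_m qw d m)) - 1%:M).

Record wf_tfpm R N M (d : tfpm R N M) : Prop := WfTfpm {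
  wf_qc : forall m, qc d m != 0;
  wf_qs : forall m, qs d m != 0;
  wf_quadrants : forall b1 b2 : bool,
    #|[set m | (0 < qc d m) == b1 & (0 < qs d m) == b2]| = M;
  wf_eps : 0 < eps d;
  wf_sigT : forall C, 0 < sigT d C;
  wf_eigen : forall C k,
    transport d C k.1.1 *m xi d C k = lam d C k *: xi d C k;
  wf_xi_norm : forall C k, `|xi d C k| = 1;
  (* for each axis these are all the 4M eigenpairs *)
  wf_xi_free : forall C (a : bool) (al : bool -> 'I_(2 * M) -> R),
    \sum_(u : bool) \sum_(j < 2 * M) al u j *: xi d C ((a, u), j) = 0 ->
    forall u j, al u j = 0;
  wf_lam : forall C k, (lam d C k < 0) = ~~ k.1.2
}.

(** * Piecewise functions

    One R^{4M}-valued function for each level-0 cell, kept through its formula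
    on the whole plane; it is only evaluated on the closed cell. *)
Definition pw (R : realType) (N M : nat) : Type :=
  cell N 0 -> R * R -> 'cV[R]_(4 * M).

Definition phi R N M (d : tfpm R N M) (C : cell N 0) (k : idx M) : pw R N M :=
  fun C' z =>
    if C' == C then
      expR (lam d C k * sT d C *
            ((if k.1.1 then z.2 else z.1) - (pos C k.1.1 + k.1.2)%:R / N%:R))
        *: xi d C k
    else 0.

Definition center (R : realType) N (C : cell N 0) : R * R :=
  ((C.1%:R + 2^-1) / N%:R, (C.2%:R + 2^-1) / N%:R).

Definition midpoint (R : realType) N (i : edge N) : R * R :=
  let n := (epos i)%:R / N%:R in
  let t := ((etan i)%:R + 2^-1) / N%:R in
  if eaxis i then (t, n) else (n, t).

(** V_{delta,C} *)
Definition threshold R N M (d : tfpm R N M) (delta : R) : selection N M :=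
  fun C => [set k | delta < `|phi d C k C (center R C)|].

(** One-sided value f(x_i)|_C, for [i] on the boundary of [C]: exactly one
    level-0 cell contributes to the sum. *)
Definition trace R N M (f : pw R N M) l (C : cell N l) (i : edge N) :
    'cV[R]_(4 * M) :=
  \sum_(C0 : cell N 0 | subcell C0 C && on_bd C0 i) f C0 (midpoint R i).

(** Jump across an inner edge [i], the orientation of the edges being [ori]; the
    cell of which [i] is the lower (resp. upper) side lies above (resp. below). *)
Definition jump R N M (ori : edge N -> bool) (f : pw R N M) (i : edge N) :
    'cV[R]_(4 * M) :=
  (-1) ^+ (ori i) *:
  (\sum_(C0 : cell N 0 | on_side C0 (eaxis i, false) i) f C0 (midpoint R i)
   - \sum_(C0 : cell N 0 | on_side C0 (eaxis i, true) i) f C0 (midpoint R i)).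

(** * Projections *)

(** All components for an inner edge, the inflow ones for a boundary edge. *)
Definition kept R N M (d : tfpm R N M) (i : edge N) (m : 'I_(4 * M)) : bool :=
  (i \notin bnd N) ||
  ((if epos i == 0%N then -1 else 1) * qdir d (eaxis i) m < 0).

(** R^{2M} (inflow components) is identified with the space of the vectors of
    R^{4M} whose other components vanish. *)
Definition restr R N M (d : tfpm R N M) (i : edge N) (v : 'cV[R]_(4 * M)) :
    'cV[R]_(4 * M) :=
  \col_m (if kept d i m then v m 0 else 0).

(** Indices of the basis functions centered on [i] from an adjacent cell: 4M
    indices for an inner edge, 2M for a boundary edge. *)
Definition edge_idx N M (i : edge N) : {set idx M} :=
  [set k | [exists C0 : cell N 0, on_side C0 k.1 i]].

(** The vector attached to [k] in [edge_idx i] (a one-term sum). *)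
Definition edge_vec R N M (d : tfpm R N M) (i : edge N) (k : idx M) :
    'cV[R]_(4 * M) :=
  restr d i (\sum_(C0 : cell N 0 | on_side C0 k.1 i) xi d C0 k).

(** The vectors [edge_vec d i k] form a basis of the image of [restr d i]. *)
Definition edge_basis R N M (d : tfpm R N M) (i : edge N) : Prop :=
  (forall v, exists al : idx M -> R,
     restr d i v = \sum_(k in edge_idx M i) al k *: edge_vec d i k) /\
  (forall al : idx M -> R,
     \sum_(k in edge_idx M i) al k *: edge_vec d i k = 0 ->
     {in edge_idx M i, forall k, al k = 0}).

(** [chi] is obtained from the basis by a QR factorization of the selected
    vectors, for some order of the columns and some choice of signs, and by
    normalization in the sup norm. *)
Record edge_qr R N M (d : tfpm R N M) (V : selection N M) (i : edge N) : Prop :=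
  EdgeQr {
  qr_norm : {in edge_idx M i, forall k, `|chi d i k| = 1};
  qr_rest : {in edge_idx M i, forall k, k \notin selE V i ->
    chi d i k = `|edge_vec d i k|^-1 *: edge_vec d i k};
  qr_orth : {in selE V i &, forall k k', k != k' ->
    (chi d i k)^T *m chi d i k' = 0};
  qr_triangular : exists2 rk : idx M -> nat, injective rk &
    exists T : idx M -> idx M -> R, {in selE V i, forall k,
      edge_vec d i k =
      \sum_(k' in selE V i | (rk k' <= rk k)%N) T k' k *: chi d i k'}
}.

(** P_{delta,i}^k v: the coefficient of [chi d i k] in the expansion of [v]. *)
Definition proj R N M (d : tfpm R N M) (i : edge N) (k : idx M)
    (v : 'cV[R]_(4 * M)) : R :=
  xget (0 : {ffun idx M -> R})
    [set al : {ffun idx M -> R} |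
      restr d i v = \sum_(k' in edge_idx M i) al k' *: chi d i k']%classic k.

(** * Data vectors *)
Definition dof R N M (d : tfpm R N M) (V : selection N M) l (f : pw R N M) :
    dofT V l -> R :=
  fun x => proj d (val x).1.2 (val x).2 (trace f (val x).1.1 (val x).1.2).
Definition bdof R N M (d : tfpm R N M) (V : selection N M) l (f : pw R N M) :
    bdofT V l -> R :=
  fun x => proj d (val x).1.2 (val x).2 (trace f (val x).1.1 (val x).1.2).
Definition jumps R N M (d : tfpm R N M) (V : selection N M)
    (ori : edge N -> bool) (S : {set edge N}) (f : pw R N M) : jumpT V S -> R :=
  fun x => proj d (val x).1 (val x).2 (jump ori f (val x).1).
Definition rhs R N M (d : tfpm R N M) (V : selection N M)
    (ori : edge N -> bool) l (f : pw R N M) : rhsT V l -> R :=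
  fun x => match x with
           | inl y => bdof d f y
           | inr y => jumps d ori f y
           end.

(** * Solution spaces *)
Fixpoint Fspace R N M (d : tfpm R N M) (V : selection N M)
    (ori : edge N -> bool) (l : nat) (f : pw R N M) : Prop :=
  match l with
  | 0 => exists al : cell N 0 -> idx M -> R, forall C' z,
      f C' z = \sum_(C : cell N 0) \sum_(k in V C) al C k *: phi d C k C' z
  | l'.+1 => Fspace d V ori l' f /\
      forall i, i \in inner N l' :\: inner N l'.+1 ->
      forall k, k \in selE V i -> proj d i k (jump ori f i) = 0
  end.

(** [Gspace d V ori l] is G_delta^(l+1), a subspace of F_delta^(l). *)
Definition Gspace R N M (d : tfpm R N M) (V : selection N M)
    (ori : edge N -> bool) (l : nat) (f : pw R N M) : Prop :=
  Fspace d V ori l f /\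
  forall (C : cell N l.+1) i, on_bd C i ->
  forall k, k \in selC V C i -> proj d i k (trace f C i) = 0.

Definition unique_solvability R N M (d : tfpm R N M) (V : selection N M)
    (ori : edge N -> bool) (L : nat) : Prop :=
  (forall l, (l <= L)%N -> forall v : dofT V l -> R,
     exists! f, Fspace d V ori l f /\ dof d f = v) /\
  (forall l, (l < L)%N -> forall v : jumpT V (skel N l :\: skel N l.+1) -> R,
     exists! f, Gspace d V ori l f /\ jumps d ori f = v).

(** * Operators *)

(** The linear map x f |-> y f, for f in F, is a bijection. *)
Definition map_bijective T (R : realType) (X Y : finType) (F : T -> Prop)
    (x : T -> X -> R) (y : T -> Y -> R) : Prop :=
  forall w : Y -> R, exists! v : X -> R, exists f, [/\ F f, x f = v & y f = w].

(** [A] is the matrix of the linear map x f |-> y f, for f in F. *)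
Definition matrix_of T (R : realType) (X Y : finType) (F : T -> Prop)
    (x : T -> X -> R) (y : T -> Y -> R) (A : Y -> X -> R) : Prop :=
  forall f, F f -> forall j, y f j = \sum_(i : X) A j i * x f i.

Definition B_bijective R N M (d : tfpm R N M) (V : selection N M)
    (ori : edge N -> bool) (L : nat) : Prop :=
  forall l, (l <= L)%N ->
    map_bijective (Fspace d V ori l) (@dof R N M d V l) (@rhs R N M d V ori l).

Section Matrices.
Context (R : realType) (N M : nat) (d : tfpm R N M) (V : selection N M).
Context (ori : edge N -> bool).

Definition is_B l : (rhsT V l -> dofT V l -> R) -> Prop :=
  matrix_of (Fspace d V ori l) (@dof R N M d V l) (@rhs R N M d V ori l).

Definition is_P l : (dofT V l -> dofT V l.+1 -> R) -> Prop :=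
  matrix_of (Fspace d V ori l.+1) (@dof R N M d V l.+1) (@dof R N M d V l).

Definition is_Q l :
    (dofT V l -> jumpT V (skel N l :\: skel N l.+1) -> R) -> Prop :=
  matrix_of (Gspace d V ori l)
    (@jumps R N M d V ori (skel N l :\: skel N l.+1)) (@dof R N M d V l).

Definition is_R l : (rhsT V l.+1 -> rhsT V l -> R) -> Prop :=
  matrix_of (Fspace d V ori l)
    (@rhs R N M d V ori l) (@rhs R N M d V ori l.+1).

Definition is_Rcheck l :
    (jumpT V (inner N l :\: inner N l.+1) -> rhsT V l -> R) -> Prop :=
  matrix_of (Fspace d V ori l)
    (@rhs R N M d V ori l) (@jumps R N M d V ori (inner N l :\: inner N l.+1)).

End Matrices.

Definition is_inverse (R : realType) (X Y : finType)
    (A : Y -> X -> R) (B : X -> Y -> R) : Prop :=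
  (forall j j', \sum_(i : X) A j i * B i j' = (j == j')%:R) /\
  (forall i i', \sum_(j : Y) B i j * A j i' = (i == i')%:R).

(** The matrices of the multilevel decomposition, with entries in [T]. *)
Record decomposition (T : Type) N M (V : selection N M) (L : nat) :=
  Decomposition {
  mB : forall l, rhsT V l -> dofT V l -> T;
  mP : forall l, dofT V l -> dofT V l.+1 -> T;
  mQ : forall l, dofT V l -> jumpT V (skel N l :\: skel N l.+1) -> T;
  mR : forall l, rhsT V l.+1 -> rhsT V l -> T;
  mRcheck : forall l, jumpT V (inner N l :\: inner N l.+1) -> rhsT V l -> T;
  mBinv : dofT V L -> rhsT V L -> T
}.

(** [D] is correct once its entries are evaluated by [ev]. *)
Definition correct_decomposition R N M (d : tfpm R N M) (V : selection N M)
    (ori : edge N -> bool) (L : nat) (T : Type) (ev : T -> R)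
    (D : decomposition T V L) : Prop :=
  [/\ forall l, (l <= L)%N -> is_B d ori (fun x y => ev (mB D (l := l) x y)),
      forall l, (l < L)%N ->
        is_P d ori (fun x y => ev (mP D (l := l) x y)) /\
        is_Q d ori (fun x y => ev (mQ D (l := l) x y)),
      forall l, (l < L)%N ->
        is_R d ori (fun x y => ev (mR D (l := l) x y)) /\
        is_Rcheck d ori (fun x y => ev (mRcheck D (l := l) x y))
    & is_inverse (fun x y => ev (mB D (l := L) x y))
                 (fun x y => ev (mBinv D x y))].

(** * Cost model

    Sequential programs over real registers without loops (for given discrete
    data the loops of an algorithm are unrolled).  Every scalar operation +, -,
    *, / and every comparison costs 1; reading a constant 0 or 1, an input or a
    register is free, so that structurally zero entries cost nothing.  There is
    no matrix primitive: dense linear algebra is paid by its scalar operations. *)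
Inductive arith := Add | Sub | Mul | Div.

Inductive operand (X : Type) :=
  | Cst of bool
  | Inp of X
  | Reg of nat.

Inductive prog (X : Type) :=
  | Skip
  | Assign of nat & arith & operand X & operand X
  | Seq of prog X & prog X
  | IfLe of operand X & operand X & prog X & prog X.

(** Worst case over the branches. *)
Fixpoint cost X (p : prog X) : nat :=
  match p with
  | Skip => 0
  | Assign _ _ _ _ => 1
  | Seq p1 p2 => cost p1 + cost p2
  | IfLe _ _ p1 p2 => (maxn (cost p1) (cost p2)).+1
  end.

Definition operand_val (R : realType) X (inp : X -> R) (mem : nat -> R)
    (a : operand X) : R :=
  match a with
  | Cst b => b%:R
  | Inp x => inp x
  | Reg n => mem n
  end.

(** A division by zero fails. *)
Definition arith_val (R : realType) (o : arith) (x y : R) : option R :=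
  match o with
  | Add => Some (x + y)
  | Sub => Some (x - y)
  | Mul => Some (x * y)
  | Div => if y == 0 then None else Some (x / y)
  end.

Fixpoint exec (R : realType) X (inp : X -> R) (p : prog X) (mem : nat -> R) :
    option (nat -> R) :=
  match p with
  | Skip => Some mem
  | Assign n o a b =>
      omap (fun v n' => if n' == n then v else mem n')
        (arith_val o (operand_val inp mem a) (operand_val inp mem b))
  | Seq p1 p2 => obind (exec inp p2) (exec inp p1 mem)
  | IfLe a b p1 p2 =>
      if operand_val inp mem a <= operand_val inp mem b
      then exec inp p1 mem else exec inp p2 mem
  end.

(** The inputs P_{delta,i}^{k'}(phi_C^k(x_i)|_C): an element is (C, k, i, k'). *)
Definition inputT N M (V : selection N M) : finType :=
  {x : cell N 0 * idx M * edge N * idx M |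
    [&& x.1.1.2 \in V x.1.1.1, on_bd x.1.1.1 x.1.2 & x.2 \in selE V x.1.2]}.

Definition input R N M (d : tfpm R N M) (V : selection N M) : inputT V -> R :=
  fun x => let: (C, k, i, k') := val x in
           proj d i k' (trace (phi d C k) C i).
Arguments input {R N M} d V.

(* Main.v *)
Require Import Defs.
From mathcomp Require Import all_boot all_order all_algebra.
From mathcomp Require Import all_classical all_reals all_analysis.
From mathcomp Require Import zify.
Set Implicit Arguments.
Unset Strict Implicit.
Unset Printing Implicit Defensive.
Import Order.TTheory GRing.Theory Num.Theory.
Local Open Scope classical_set_scope.
Local Open Scope ring_scope.

(* Each F^(l) has the basis dual to the degrees of freedom on the boundaries of
   the level-l cells, and a basis function vanishes outside its cell.  In these
   bases the map sending f in F^(l) to its degrees of freedom at level l+1 and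
   its jumps across the edges that disappear is block diagonal over the cells of
   level l+1, with blocks of size O(2^l r), and its inverse consists of P^(l) and
   Q^(l).  Hence level l costs O((N / 2^l)^2 (2^l r)^3) = O(N^2 2^l r^3), which
   sums geometrically to O(N^3 r^3).  A nonsingular block A is inverted as
   A^T (A A^T)^-1 by elimination on a positive definite matrix, where no pivot
   vanishes; a single straight-line program thus serves all data. *)

(** * Programs over an abstract set of data *)

(** The program and the locations of its outputs are fixed before the data [d], whereas the matrices
    exist only through unique solvability for [d]. Their entries are therefore treated as functions
    on the type of admissible data, and costs are attached to deriving such functions from one
    another; registers appear only in a final compilation. The degrees of freedom of a basis
    function do not determine its projected jumps: at an edge they record only the indices selected
    on its own side, while a jump is also projected on the indices of the other side. So the
    projected edge values of all basis functions are carried from level to level, P giving the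
    coefficients that express those of level l+1 through those of level l. At level 0 they come from
    the inputs after inverting one block of size 4r per cell. The coarse degrees of freedom are
    among the fine ones, so R and its complement are constant 0-1 matrices and cost nothing. The
    dense inverse at level L fits the bound because the number of cells there is at most [coarse]
    squared. *)

Section Computability.
Context (R : realType) (G : Type).
Implicit Types (K Q : set (G -> R)) (q : G -> R) (c : nat).

(* A quantity is a function of the data [g : G]; one operation produces a new
   quantity from two known ones, uniformly in the data. *)
Definition arith_step K q : Prop :=
  exists o a b, [/\ K a, K b & forall g, arith_val o (a g) (b g) = Some (q g)].

(** Straight-line code in single-assignment form: what has been computed stays known, and there is
    no branching. The number is a budget rather than an exact count, since the first constructor
    accepts any [c]. *)
Inductive computable : set (G -> R) -> nat -> set (G -> R) -> Prop :=
  | computable_sub K c Q : Q `<=` K -> computable K c Q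
  | computable_step K c Q q :
      arith_step K q -> computable (q |` K) c Q -> computable K c.+1 Q.

Lemma arith_step_sub K K' q : K `<=` K' -> arith_step K q -> arith_step K' q.
Proof.
by move=> KK' [op [a [b [Ka Kb h]]]]; exists op, a, b; split => //; apply: KK'.
Qed.

Lemma computable_weak K K' c c' Q Q' : K `<=` K' -> (c <= c')%N -> Q' `<=` Q ->
  computable K c Q -> computable K' c' Q'.
Proof.
move=> KK' cc' QQ' H; elim: H K' c' Q' KK' cc' QQ' => {K c Q}.
  move=> K c Q QK K' c' Q' KK' _ Q'Q; apply: computable_sub.
  by apply: subset_trans Q'Q _; apply: subset_trans QK KK'.
move=> K c Q q hq _ IH K' [//|c'] Q' KK' cc' Q'Q.
apply: (computable_step (q := q)); first exact: arith_step_sub hq.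
by apply: IH => //; apply: setUS.
Qed.

Lemma computable_trans K c1 Q1 c2 Q2 : computable K c1 Q1 ->
  computable (K `|` Q1) c2 Q2 -> computable K (c1 + c2)%N Q2.
Proof.
elim=> {K c1 Q1} [K c Q QK|K c Q q hq _ IH] H2.
  by apply: computable_weak H2 => //; [rewrite subUset; split|apply: leq_addl].
rewrite addSn; apply: (computable_step hq); apply: IH.
by apply: computable_weak H2 => //; apply: setSU; apply: subsetUr.
Qed.

Lemma computable_keep K c Q : computable K c Q -> computable K c (K `|` Q).
Proof.
elim=> {K c Q} [K c Q QK|K c Q q hq _ IH].
  by apply: computable_sub; rewrite subUset; split.
apply: (computable_step hq); apply: computable_weak IH => //.
by apply: setSU; apply: subsetUr.
Qed.

Lemma computableU K c1 Q1 c2 Q2 : computable K c1 Q1 ->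
  computable (K `|` Q1) c2 Q2 -> computable K (c1 + c2)%N (K `|` Q1 `|` Q2).
Proof. by move=> h1 h2; apply: (computable_trans h1); apply: computable_keep. Qed.

Lemma computable_chain K c1 K1 c2 Q : K `<=` K1 -> computable K c1 K1 ->
  computable K1 c2 Q -> computable K (c1 + c2)%N Q.
Proof.
move=> KK1 h1 h2; apply: (computable_trans h1).
by rewrite (setUidr KK1).
Qed.

(** Only the indices in [P] are paid for; this is how entries known to vanish are kept out of the
    count. Each family member is derived from [K] alone, so the budgets add along an enumeration of
    [P]. *)
Lemma computable_family (J : finType) (P : pred J) K c (Q : J -> set (G -> R)) :
  (forall j, ~~ P j -> Q j `<=` K) -> (forall j, P j -> computable K c (Q j)) ->
  computable K (#|P| * c)%N (\bigcup_j Q j).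
Proof.
move=> hN hP.
have H (s : seq J) : all P s ->
    computable K (size s * c)%N (K `|` \bigcup_(j in [set` s]) Q j).
  elim: s => [_|j s IH /= /andP[Pj Ps]].
    by apply: computable_sub; rewrite subUset; split => //; rewrite set_nil bigcup_set0.
  rewrite mulSn addnC; apply: (computable_trans (IH Ps)).
  have := computable_weak (@subsetUl _ K (K `|` \bigcup_(j in [set` s]) Q j))
    (leqnn _) (@subset_refl _ _) (hP j Pj).
  rewrite setUA setUid => /computable_keep; apply: computable_weak => //.
  move=> q [Kq|[i /= ]]; first by left; left.
  rewrite inE => /orP[/eqP -> ?|si Qi]; [by right|by left; right; exists i].
have allPe : all P (enum P) by apply/allP => j; rewrite mem_enum.
have := H _ allPe; rewrite -cardE; apply: computable_weak => //.
move=> q [j _ Qj]; have [Pj|nPj] := boolP (P j).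
  by right; exists j => //=; rewrite mem_enum.
by left; apply: hN Qj.
Qed.

Lemma computable_op o K (a b q : G -> R) : K a -> K b ->
  (forall g, arith_val o (a g) (b g) = Some (q g)) -> computable K 1 [set q].
Proof.
move=> Ka Kb h; apply: (computable_step (q := q)); first by exists o, a, b.
by apply: computable_sub; apply: subsetUl.
Qed.

(** Two operations per term, a product and an accumulation started from the free constant 0. *)
Lemma computable_sum (J : finType) (P : pred J) K (a b : J -> G -> R) :
  K (fun=> 0) -> (forall j, P j -> K (a j)) -> (forall j, P j -> K (b j)) ->
  computable K (2 * #|P|)%N [set fun g => \sum_(j | P j) a j g * b j g].
Proof.
move=> K0 Ka Kb; pose S s := fun g => \sum_(j <- s) a j g * b j g.
have H (s : seq J) : all P s -> computable K (2 * size s)%N (K `|` [set S s]).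
  elim: s => [_|j s IH /= /andP[Pj Ps]].
    apply: computable_sub; rewrite subUset; split => // _ ->.
    by rewrite (_ : S _ = (fun=> 0)) //; apply: funext => g; rewrite /S big_nil.
  rewrite mulnS addnC; apply: (computable_trans (IH Ps)).
  pose q1 := fun g => a j g * b j g.
  apply: (computable_step (q := q1)).
    by exists Mul, (a j), (b j); split => //; left; [apply: Ka|apply: Kb].
  apply: (computable_step (q := S (j :: s))).
    exists Add, q1, (S s); split; [by left|by right; right; right|].
    by move=> g; rewrite /S big_cons.
  apply: computable_sub => q [Kq|->]; last by left.
  by right; right; left.
have allPe : all P (enum P) by apply/allP => j; rewrite mem_enum.
have := H _ allPe; rewrite -cardE; apply: computable_weak => //.
move=> _ ->; right; apply: funext => g.
by rewrite /S big_enum.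
Qed.

End Computability.

(** * Elimination without pivoting on positive definite matrices *)

Section Inversion.
Context (R : realType) (G : Type).
Implicit Types (K : set (G -> R)) (c : nat).

Definition mx_entries m n (A : G -> 'M[R]_(m, n)) : set (G -> R) :=
  [set q | exists i j, q = fun g => A g i j].

Lemma mx_addE m n (A B : 'M[R]_(m, n)) i j : (A + B) i j = A i j + B i j.
Proof. by rewrite mxE. Qed.

Lemma mx_subE m n (A B : 'M[R]_(m, n)) i j : (A - B) i j = A i j - B i j.
Proof. by rewrite !mxE. Qed.

Lemma computable_entries K c m n (A : G -> 'M[R]_(m, n)) :
  (forall i j, computable K c [set fun g => A g i j]) ->
  computable K (m * n * c)%N (mx_entries A).
Proof.
move=> hA.
have : computable K (#|{: 'I_m * 'I_n}| * c)%N
    (\bigcup_(ij : 'I_m * 'I_n) [set fun g => A g ij.1 ij.2]).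
  by apply: computable_family => // ij _; apply: hA.
rewrite card_prod !card_ord; apply: computable_weak => //.
by move=> _ [i [j ->]]; exists (i, j).
Qed.

Lemma computable_mulmx K m n p (A : G -> 'M[R]_(m, n)) (B : G -> 'M[R]_(n, p)) :
  K (fun=> 0) -> mx_entries A `<=` K -> mx_entries B `<=` K ->
  computable K (m * p * (2 * n))%N (mx_entries (fun g => A g *m B g)).
Proof.
move=> K0 hA hB; apply: computable_entries => i j.
have : computable K (2 * #|'I_n|)%N [set fun g => \sum_k A g i k * B g k j].
  apply: computable_sum => // k _; [by apply: hA; exists i, k|].
  by apply: hB; exists k, j.
rewrite card_ord; apply: computable_weak => //.
by move=> _ ->; apply: funext => g; rewrite mxE.
Qed.

Definition pos_def n (S : 'M[R]_n) : Prop :=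
  forall v : 'rV[R]_n, v != 0 -> 0 < (v *m S *m v^T) 0 0.

Section SchurComplement.
Context (n : nat) (S : 'M[R]_(1 + n)).
Let a := S 0 0.
Let w := a^-1 *: dlsubmx S.
Let schur := drsubmx S - w *m ursubmx S.

Lemma pos_def_pivot : pos_def S -> 0 < a.
Proof.
move=> /(_ (delta_mx 0 0)); rewrite -rowE => /(_ _); rewrite !mxE.
rewrite (bigD1 0) //= !mxE eqxx mulr1 big1 ?addr0; first apply.
  by apply/eqP => /rowP /(_ 0); rewrite !mxE eqxx /= => /eqP; rewrite oner_eq0.
by move=> i i0; rewrite !mxE (negPf i0) andbF mulr0.
Qed.

Let S_block : S = block_mx a%:M (ursubmx S) (dlsubmx S) (drsubmx S).
Proof.
rewrite -[LHS]submxK; congr block_mx; apply/matrixP => i j.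
by rewrite !ord1 !mxE eqxx mulr1n /a; congr (S _ _); apply: val_inj.
Qed.

(** The row vector (-v w, v) is chosen to annihilate the first column of [S], so the form of [S] at
    this vector equals the form of [schur] at [v]. *)
Lemma pos_def_schur : pos_def S -> pos_def schur.
Proof.
move=> hS; have a0 := lt0r_neq0 (pos_def_pivot hS).
move=> v v0; have := hS (row_mx (- (v *m w)) v).
have -> : row_mx (- (v *m w)) v *m S = row_mx 0 (v *m schur).
  rewrite [X in _ *m X]S_block mul_row_block; congr row_mx.
    rewrite mul_mx_scalar scalerN -scalemxAr scalerA divff // scale1r.
    by rewrite addNr.
  by rewrite mulmxBr mulNmx mulmxA addrC.
rewrite tr_row_mx mul_row_col mul0mx add0r; apply.
by apply: contraNneq v0 => /(congr1 (@rsubmx _ _ _ _)); rewrite row_mxKr => ->; rewrite linear0.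
Qed.

(** The classical block inversion formula, needing only a right inverse [H] of the Schur complement,
    which is what the recursion supplies. *)
Lemma schur_inverse (H : 'M[R]_n) : a != 0 -> schur *m H = 1%:M ->
  let w' := a^-1 *: ursubmx S in
  S *m block_mx ((a^-1)%:M + w' *m H *m w) (- (w' *m H)) (- (H *m w)) H = 1%:M.
Proof.
move=> a0 hH w'; rewrite [X in X *m _]S_block mulmx_block.
have aw' : a *: w' = ursubmx S by rewrite scalerA divff // scale1r.
have aw : a *: w = dlsubmx S by rewrite scalerA divff // scale1r.
have drH : drsubmx S *m H = 1%:M + w *m (ursubmx S *m H).
  by rewrite -hH mulmxBl mulmxA subrK.
clear hH schur; clearbody w w'.
rewrite [RHS](_ : _ = block_mx 1%:M 0 0 1%:M); last by rewrite -scalar_mx_block.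
congr block_mx.
- rewrite mulmxDr mul_scalar_mx scale_scalar_mx divff // !mulmxN mul_scalar_mx.
  by rewrite scalemxAl scalemxAl aw' mulmxA addrK.
- by rewrite mulmxN mul_scalar_mx scalemxAl aw' addNr.
- rewrite mulmxDr mulmxN [drsubmx S *m _]mulmxA drH mulmxDl mul1mx.
  rewrite mul_mx_scalar -aw -aw' -!scalemxAl -scalemxAr -scalemxAl.
  by rewrite scalerA mulVf // scale1r !mulmxA opprD addrACA !subrr addr0.
- rewrite mulmxN drH -aw -aw' -!scalemxAl -!scalemxAr mulmxA.
  by rewrite addrC addrK.
Qed.

End SchurComplement.

(* No pivoting: the pivots of a positive definite matrix are positive whatever
   the data, so the program has no branch. *)
Lemma computable_pos_def_inverse n K (S : G -> 'M[R]_n) :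
  K (fun=> 0) -> K (fun=> 1) -> mx_entries S `<=` K ->
  (forall g, pos_def (S g)) ->
  exists T : G -> 'M[R]_n, (forall g, S g *m T g = 1%:M) /\
    computable K (2 * n ^ 3)%N (mx_entries T).
Proof.
elim: n K S => [|n IH] K S K0 K1 KS hS.
  exists (fun=> 1%:M); split; first by move=> g; apply/matrixP => -[].
  by apply: computable_sub => q [[]].
pose a g := S g 0 0.
pose ur g : 'rV[R]_n := ursubmx (S g : 'M[R]_(1 + n)).
pose dl g : 'cV[R]_n := dlsubmx (S g : 'M[R]_(1 + n)).
pose dr g : 'M[R]_n := drsubmx (S g : 'M[R]_(1 + n)).
have a0 g : a g != 0 by apply: lt0r_neq0; apply: (@pos_def_pivot n).
have Ka : K a by apply: KS; exists 0, 0.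
have Kur j : K (fun g => ur g 0 j).
  apply: KS; exists 0, (rshift 1 j); apply: funext => g.
  by rewrite !mxE; congr (S _ _ _); apply: val_inj.
have Kdl i : K (fun g => dl g i 0).
  apply: KS; exists (rshift 1 i), 0; apply: funext => g.
  by rewrite !mxE; congr (S _ _ _); apply: val_inj.
have Kdr i j : K (fun g => dr g i j).
  by apply: KS; exists (rshift 1 i), (rshift 1 j); apply: funext => g; rewrite !mxE.
pose w g := (a g)^-1 *: dl g.
pose w' g := (a g)^-1 *: ur g.
pose Sc g := dr g - w g *m ur g.
have cw : computable K (n * 1 * 1)%N (mx_entries w).
  apply: computable_entries => i j; rewrite ord1.
  apply: (computable_op (o := Div) (Kdl i) Ka) => g /=.
  by rewrite (negPf (a0 g)) !mxE mulrC.
have cw' : computable K (1 * n * 1)%N (mx_entries w').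
  apply: computable_entries => i j; rewrite ord1.
  apply: (computable_op (o := Div) (Kur j) Ka) => g /=.
  by rewrite (negPf (a0 g)) !mxE mulrC.
have {cw'}cww := computableU cw
  (computable_weak (@subsetUl _ K _) (leqnn _) (@subset_refl _ _) cw').
set K2 := (X in computable _ _ X) in cww.
have K2K : K `<=` K2 by move=> q; left; left.
have K2w i j : K2 (fun g => w g i j) by left; right; exists i, j.
have K2w' i j : K2 (fun g => w' g i j) by right; exists i, j.
have cwu : computable K2 (n * n * 1)%N (mx_entries (fun g => w g *m ur g)).
  apply: computable_entries => i j.
  apply: (computable_op (o := Mul) (K2w i 0) (K2K _ (Kur j))) => g /=.
  by rewrite !mxE big_ord1 !mxE.
have cSc : computable (K2 `|` mx_entries (fun g => w g *m ur g)) (n * n * 1)%N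
    (mx_entries Sc).
  apply: computable_entries => i j.
  have K'w : (K2 `|` mx_entries (fun g => w g *m ur g)) (fun g => (w g *m ur g) i j).
    by right; exists i, j.
  apply: (computable_op (o := Defs.Sub) (or_introl (K2K _ (Kdr i j))) K'w) => g /=.
  by rewrite /Sc mx_subE.
have {cwu cSc} := computable_keep (computable_trans cwu cSc).
set K3 := (X in computable _ _ X) => cSc.
have K3K : K2 `<=` K3 by move=> q; left.
have [] := IH K3 Sc.
- by apply/K3K/K2K.
- by apply/K3K/K2K.
- by move=> q; right.
- by move=> g; apply: (@pos_def_schur n).
move=> H [hH /computable_keep cH]; set K4 := (X in computable _ _ X) in cH.
have K4K : K3 `<=` K4 by move=> q; left.
have K42 : K2 `<=` K4 by move=> q /K3K /K4K.
have K40 : K4 (fun=> 0) by apply/K42/K2K.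
have cu : computable K4 (n * 1 * (2 * n))%N (mx_entries (fun g => H g *m w g)).
  apply: computable_mulmx => //; first by move=> q; right.
  by move=> _ [i [j ->]]; apply: K42.
have cv : computable K4 (1 * n * (2 * n))%N (mx_entries (fun g => w' g *m H g)).
  apply: computable_mulmx => //; last by move=> q; right.
  by move=> _ [i [j ->]]; apply: K42.
have := computableU cu (computable_weak (@subsetUl _ K4 _) (leqnn _) (@subset_refl _ _) cv).
set K5 := (X in computable _ _ X) => cuv.
have K5K : K4 `<=` K5 by move=> q; left; left.
have K5u i j : K5 (fun g => (H g *m w g) i j) by left; right; exists i, j.
have K5v i j : K5 (fun g => (w' g *m H g) i j) by right; exists i, j.
have cs : computable K5 (1 * 1 * (2 * n))%N
    (mx_entries (fun g => w' g *m H g *m w g)).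
  apply: computable_mulmx; first exact: K5K.
    by move=> _ [i [j ->]]; apply: K5v.
  by move=> _ [i [j ->]]; apply: K5K; apply: K42.
have {cs} := computable_keep cs.
set K6 := (X in computable _ _ X) => cs.
have K6K : K5 `<=` K6 by move=> q; left.
have K6K0 : K `<=` K6 by move=> q /K2K /K42 /K5K /K6K.
have ci : computable K6 1 [set fun g => (a g)^-1].
  apply: (computable_op (o := Div) (K6K0 _ K1) (K6K0 _ Ka)) => g /=.
  by rewrite (negPf (a0 g)) mul1r.
pose corner g := ((a g)^-1)%:M + w' g *m H g *m w g.
have cc : computable (K6 `|` [set fun g => (a g)^-1]) (1 * 1 * 1)%N
    (mx_entries corner).
  apply: computable_entries => i j.
  have K6s : K6 (fun g => (w' g *m H g *m w g) i j) by right; exists i, j.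
  apply: (computable_op (o := Add) (or_intror erefl) (or_introl K6s)) => g.
  by rewrite /= /corner mx_addE !ord1 [(_%:M) _ _]mxE eqxx mulr1n.
have {ci cc} := computable_keep (computable_trans ci cc).
set K7 := (X in computable _ _ X) => cc.
have K7K : K6 `<=` K7 by move=> q; left.
have K70 : K7 (fun=> 0) by apply/K7K/K6K0.
have cnu : computable K7 (n * 1 * 1)%N (mx_entries (fun g => - (H g *m w g))).
  apply: computable_entries => i j.
  apply: (computable_op (o := Defs.Sub) K70 (K7K _ (K6K _ (K5u i j)))) => g /=.
  by rewrite sub0r [in RHS]mxE.
have cnv : computable K7 (1 * n * 1)%N (mx_entries (fun g => - (w' g *m H g))).
  apply: computable_entries => i j.
  apply: (computable_op (o := Defs.Sub) K70 (K7K _ (K6K _ (K5v i j)))) => g /=.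
  by rewrite sub0r [in RHS]mxE.
have := computableU cnu (computable_weak (@subsetUl _ K7 _) (leqnn _) (@subset_refl _ _) cnv).
set K8 := (X in computable _ _ X) => cn.
exists (fun g => block_mx (corner g) (- (w' g *m H g)) (- (H g *m w g)) (H g)).
split.
  by move=> g; have := @schur_inverse n (S g) (H g) (a0 g) (hH g).
have := computable_chain K2K cww (computable_chain K3K cSc (computable_chain K4K cH
  (computable_chain K5K cuv (computable_chain K6K cs (computable_chain K7K cc cn))))).
(* The recursive call takes 2 n^3 and the rest 6 n^2 + 6 n + 2 operations, in total exactly 2 (n +
   1)^3. *)
apply: computable_weak => //; first by lia.
move=> _ [i [j ->]].
have K8K : K7 `<=` K8 by move=> q; left; left.
case: (split_ordP (i : 'I_(1 + n))) => i' ->;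
  case: (split_ordP (j : 'I_(1 + n))) => j' ->.
- apply/K8K; right; exists i', j'; apply: funext => g; exact: block_mxEul.
- right; exists i', j'; apply: funext => g; exact: block_mxEur.
- left; right; exists i', j'; apply: funext => g; exact: block_mxEdl.
- apply/K8K/K7K/K6K/K5K; right; exists i', j'; apply: funext => g; exact: block_mxEdr.
Qed.

End Inversion.

(** * Matrices indexed by finite types, inversion by blocks *)

Section FiniteInverse.
Context (R : realType).

Definition fin_mx (X Y : finType) (A : Y -> X -> R) : 'M[R]_(#|Y|, #|X|) :=
  \matrix_(y, x) A (enum_val y) (enum_val x).

Lemma fin_mxE (X Y : finType) (A : Y -> X -> R) y x :
  fin_mx A (enum_rank y) (enum_rank x) = A y x.
Proof. by rewrite mxE !enum_rankK. Qed.

Lemma fin_mx_inj (X Y : finType) (A B : Y -> X -> R) :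
  fin_mx A = fin_mx B -> forall y x, A y x = B y x.
Proof. by move=> AB y x; rewrite -(fin_mxE A) AB fin_mxE. Qed.

Lemma fin_mxM (X Y Z : finType) (A : Y -> X -> R) (B : X -> Z -> R) :
  fin_mx A *m fin_mx B = fin_mx (fun y z => \sum_x A y x * B x z).
Proof.
apply/matrixP => i j; rewrite !mxE (reindex (@enum_rank X)) /=; last first.
  exact: onW_bij (@enum_rank_bij X).
by apply: eq_bigr => x _; rewrite !mxE enum_rankK.
Qed.

Lemma fin_mx1 (X : finType) : fin_mx (fun x y : X => (x == y)%:R) = 1%:M.
Proof. by apply/matrixP => i j; rewrite !mxE (inj_eq enum_val_inj). Qed.

Lemma fin_mx_inverse (X Y : finType) (A : Y -> X -> R) (B : X -> Y -> R) :
  is_inverse A B <-> fin_mx A *m fin_mx B = 1%:M /\ fin_mx B *m fin_mx A = 1%:M.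
Proof.
rewrite !fin_mxM -!fin_mx1; split=> [[AB BA]|[AB BA]].
  by split; apply/matrixP => i j; rewrite !mxE.
by split; apply: fin_mx_inj.
Qed.

Lemma is_inverse_card (X Y : finType) (A : Y -> X -> R) (B : X -> Y -> R) :
  is_inverse A B -> #|X| = #|Y|.
Proof.
move=> /fin_mx_inverse [AB BA].
have le m n (C : 'M[R]_(m, n)) D : C *m D = 1%:M -> (m <= n)%N.
  by move=> CD; rewrite -(mxrank1 R m) -CD (leq_trans (mxrankM_maxl _ _)) ?rank_leq_col.
by apply/eqP; rewrite eqn_leq (le _ _ _ _ BA) (le _ _ _ _ AB).
Qed.

Lemma is_inverse_of_right (X Y : finType) (A : Y -> X -> R) (B : X -> Y -> R) :
  #|X| = #|Y| -> (forall j j', \sum_i A j i * B i j' = (j == j')%:R) ->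
  is_inverse A B.
Proof.
move=> XY AB; apply/fin_mx_inverse.
have {}AB : fin_mx A *m fin_mx B = 1%:M.
  by rewrite fin_mxM -fin_mx1; apply/matrixP => i j; rewrite !mxE.
split=> //; move: (fin_mx A) (fin_mx B) AB; rewrite XY => M1 M2.
exact: mulmx1C.
Qed.

(** Truncating [B] to the diagonal blocks leaves a right inverse of [A]; by uniqueness of the
    inverse, [B] is its own truncation. *)
Lemma is_inverse_block (X Y : finType) (Z : eqType) (cX : X -> Z) (cY : Y -> Z)
    (A : Y -> X -> R) (B : X -> Y -> R) :
  is_inverse A B -> (forall y x, cY y != cX x -> A y x = 0) ->
  forall x y, cX x != cY y -> B x y = 0.
Proof.
move=> [AB BA] A0.
pose B' x y := if cX x == cY y then B x y else 0.
have AB' y y' : \sum_x A y x * B' x y' = (y == y')%:R.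
  have [e|ne] := eqVneq (cY y) (cY y').
    rewrite -AB; apply: eq_bigr => x _; rewrite /B'; case: ifPn => // ne.
    by rewrite A0 ?mul0r // e eq_sym.
  rewrite big1; first by case: (eqVneq y y') ne => // ->; rewrite eqxx.
  move=> x _; rewrite /B'; case: ifPn => [/eqP e|_]; last by rewrite mulr0.
  by rewrite A0 ?mul0r // e.
have {AB'} AB' : fin_mx A *m fin_mx B' = 1%:M.
  by rewrite fin_mxM -fin_mx1; apply/matrixP => i j; rewrite !mxE.
have /fin_mx_inverse [_ BA'] : is_inverse A B by [].
have e : fin_mx B = fin_mx B' by rewrite -[RHS]mul1mx -BA' -mulmxA AB' mulmx1.
by move=> x y /negPf ne; rewrite -(fin_mxE B) e fin_mxE /B' ne.
Qed.

Context (G : Type).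

(** The constant 6 is 2 + 2 + 2: the product of A with its transpose, the elimination, and the final
    product with the transpose. *)
Lemma computable_inverse (K : set (G -> R)) (X Y : finType)
    (A : G -> Y -> X -> R) (B : G -> X -> Y -> R) :
  K (fun=> 0) -> K (fun=> 1) -> (forall y x, K (fun g => A g y x)) ->
  (forall g, is_inverse (A g) (B g)) ->
  computable K (6 * #|X| ^ 3)%N [set q | exists x y, q = fun g => B g x y].
Proof.
move=> K0 K1 KA hAB.
(* The equality of the two cardinals has to be read off some datum. If there is none, all quantities
   equal the constant 0. *)
have [[g0 _]|G0] := pselect (exists g : G, True); last first.
  apply: computable_sub => q _; rewrite (_ : q = (fun=> 0)) //.
  by apply: funext => g; case: G0; exists g.
have XY := is_inverse_card (hAB g0).
pose MA g := fin_mx (A g); pose MB g := fin_mx (B g).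
have hM g : MA g *m MB g = 1%:M /\ MB g *m MA g = 1%:M by apply/fin_mx_inverse.
have KMA : mx_entries MA `<=` K.
  move=> _ [i [j ->]]; rewrite (_ : (fun _ => _) = fun g => A g (enum_val i) (enum_val j)) //.
  by apply: funext => g; rewrite mxE.
have KMAT : mx_entries (fun g => (MA g)^T) `<=` K.
  move=> _ [i [j ->]]; rewrite (_ : (fun _ => _) = fun g => MA g j i).
    by apply: KMA; exists j, i.
  by apply: funext => g; rewrite mxE.
have cS := computable_keep (computable_mulmx K0 KMA KMAT).
set K1' := (X in computable _ _ X) in cS.
(* The form at [v] is the sum of the squares of the entries of v A, and v A is nonzero because A is
   invertible. *)
have hS g : pos_def (MA g *m (MA g)^T).
  move=> v v0; rewrite mulmxA -mulmxA -trmx_mul.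
  have w0 : v *m MA g != 0.
    apply: contraNneq v0 => /(congr1 (mulmx^~ (MB g))); rewrite -mulmxA.
    by rewrite (hM g).1 mulmx1 mul0mx => ->.
  move: (v *m MA g) w0 => u u0.
  have sq j : u 0 j * u^T j 0 = u 0 j ^+ 2 by rewrite mxE expr2.
  rewrite mxE (eq_bigr _ (fun j _ => sq j)) lt_def sumr_ge0; last by move=> j _; exact: sqr_ge0.
  rewrite andbT; apply: contraNneq u0 => /eqP.
  rewrite psumr_eq0; last by move=> j _; exact: sqr_ge0.
  move=> /allP h; apply/eqP/rowP => j; rewrite [RHS]mxE; apply/eqP.
  by have := h j (mem_index_enum _); rewrite sqrf_eq0.
have K1S : mx_entries (fun g => MA g *m (MA g)^T) `<=` K1' by move=> q; right.
have [T [hT cT]] := computable_pos_def_inverse (or_introl K0) (or_introl K1) K1S hS.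
have {cT}cT := computable_keep cT; set K2 := (X in computable _ _ X) in cT.
have KK2 : K `<=` K2 by move=> q; left; left.
have cB : computable K2 (#|X| * #|Y| * (2 * #|Y|))%N (mx_entries MB).
  have -> : MB = fun g => (MA g)^T *m T g.
    apply: funext => g; have [AB BA] := hM g.
    by rewrite -[RHS]mul1mx -BA -mulmxA [MA g *m _]mulmxA hT mulmx1.
  apply: computable_mulmx; first exact: KK2.
    by apply: subset_trans KK2.
  by move=> q; right.
have K1K : K `<=` K1' by move=> q; left.
have K12 : K1' `<=` K2 by move=> q; left.
have := computable_chain K1K cS (computable_chain K12 cT cB).
apply: computable_weak => //.
  by rewrite XY; lia.
move=> _ [x [y ->]]; exists (enum_rank x), (enum_rank y).
by apply: funext => g; rewrite fin_mxE.
Qed.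

(** Corresponding blocks of [A] and [B] are inverse to each other, because the terms outside a block
    drop out of the sums; hence each block is inverted on its own. *)
Lemma computable_block_inverse (K : set (G -> R)) (X Y Z : finType)
    (cX : X -> Z) (cY : Y -> Z) (n : nat)
    (A : G -> Y -> X -> R) (B : G -> X -> Y -> R) :
  K (fun=> 0) -> K (fun=> 1) -> (forall y x, K (fun g => A g y x)) ->
  (forall g, is_inverse (A g) (B g)) ->
  (forall g y x, cY y != cX x -> A g y x = 0) ->
  (forall z, (#|[pred x | cX x == z]| <= n)%N) ->
  computable K (#|Z| * (6 * n ^ 3))%N [set q | exists x y, q = fun g => B g x y].
Proof.
move=> K0 K1 KA hAB A0 hn.
have B0 g x y : cX x != cY y -> B g x y = 0.
  exact: (is_inverse_block (hAB g) (A0 g)).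
pose Xz z := {x : X | cX x == z}; pose Yz z := {y : Y | cY y == z}.
have hz z : computable K (6 * n ^ 3)%N
    [set q | exists (x : Xz z) (y : Yz z), q = fun g => B g (val x) (val y)].
  suff hinv g : is_inverse (fun y x => A g (val y) (val x))
      (fun (x : Xz z) (y : Yz z) => B g (val x) (val y)).
    apply: computable_weak (computable_inverse K0 K1 (fun y x => KA (val y) (val x)) hinv) => //.
    by rewrite leq_mul2l /= leq_exp2r // card_sig.
  have [AB BA] := hAB g; split=> [y y'|x x'].
    have := AB (val y) (val y'); rewrite (bigID (fun x => x \in [pred x | cX x == z])) /=.
    rewrite [X in _ + X]big1 ?addr0; last first.
      by move=> x; rewrite inE => xz; rewrite A0 ?mul0r // (eqP (valP y)) eq_sym.
    by rewrite (inj_eq val_inj y y') => <-; rewrite (big_sub [pred x | cX x == z]).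
  have := BA (val x) (val x'); rewrite (bigID (fun y => y \in [pred y | cY y == z])) /=.
  rewrite [X in _ + X]big1 ?addr0; last first.
    by move=> y; rewrite inE => yz; rewrite A0 ?mulr0 // (eqP (valP x')).
  by rewrite (inj_eq val_inj x x') => <-; rewrite (big_sub [pred y | cY y == z]).
(* The constant 0 is put in every member of the family to account for the entries off the diagonal
   blocks: an entry (x, y) is filed under [cX x] whether or not y belongs to that block. *)
have : computable K (#|Z| * (6 * n ^ 3))%N (\bigcup_z [set q | q = (fun=> 0) \/
    exists (x : Xz z) (y : Yz z), q = fun g => B g (val x) (val y)]).
  apply: computable_family => // z _; have := computable_keep (hz z).
  by apply: computable_weak => // q [->|[x [y ->]]]; [left|right; exists x, y].
apply: computable_weak => // _ [x [y ->]]; exists (cX x) => //=.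
have [yx|ne] := boolP (cY y == cX x).
  by right; exists (exist _ x (eqxx _)), (exist _ y yx).
by left; apply: funext => g; rewrite B0 // eq_sym.
Qed.

End FiniteInverse.

(** * From derivations to register programs *)

Section Compilation.
Context (R : realType) (G : Type) (X : Type) (inp : G -> X -> R).

Definition free_quantities : set (G -> R) :=
  [set q | exists a : operand X, (if a is Reg _ then False else True) /\
     q = fun g => operand_val (inp g) (fun=> 0) a].

Definition reg_below n (a : operand X) : bool := if a is Reg m then (m < n)%N else true.

(** Each new quantity goes to the fresh register [n]. The known operands refer to registers below
    [n], so no later assignment overwrites them. Program and operands are chosen before [g]. *)
Lemma compile_from K c Q : computable K c Q ->
  forall (n : nat) (opd : (G -> R) -> operand X) (m : G -> nat -> R),
  (forall q, K q -> reg_below n (opd q) /\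
     forall g, operand_val (inp g) (m g) (opd q) = q g) ->
  exists (p : prog X) (opd' : (G -> R) -> operand X), (cost p <= c)%N /\
    forall g, exists mem, exec (inp g) p (m g) = Some mem /\
      forall q, Q q -> operand_val (inp g) mem (opd' q) = q g.
Proof.
elim=> {K c Q} [K c Q QK|K c Q q [op [a [b [Ka Kb hop]]]] _ IH] n opd m hK.
  exists (Skip X), opd; split => // g; exists (m g); split => // q /QK Kq.
  by have [_] := hK q Kq.
(* Quantities are functions on [G], so their equality is decided classically; only [q] is redirected
   to the new register. *)
pose opd1 x := if pselect (x = q) then Reg X n else opd x.
pose m1 g n' := if n' == n then q g else m g n'.
have [x|p [opd' [cp hp]]] := IH n.+1 opd1 m1.
  rewrite /opd1; case: pselect => [xq _|xq [//|Kx]].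
    by split=> [|g] /=; rewrite ?ltnSn // /m1 eqxx xq.
  have [hb hv] := hK x Kx; split => [|g].
    by case: (opd x) hb => //= k; apply: ltnW.
  rewrite -hv; case: (opd x) hb => //= k kn.
  by rewrite /m1 ltn_eqF.
exists (Seq (Assign n op (opd a) (opd b)) p), opd'; split => // g.
have [mem [hmem hQ]] := hp g; exists mem; split => //=.
by rewrite (hK a Ka).2 (hK b Kb).2 hop.
Qed.

Lemma compile c Q : computable free_quantities c Q ->
  exists (p : prog X) (opd : (G -> R) -> operand X), (cost p <= c)%N /\
    forall g, exists mem, exec (inp g) p (fun=> 0) = Some mem /\
      forall q, Q q -> operand_val (inp g) mem (opd q) = q g.
Proof.
move=> /compile_from; pose opd q :=
  if pselect (free_quantities q) is left h then projT1 (cid h) else Cst X true.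
move=> /(_ 0%N opd (fun=> fun=> 0)); apply => q fq; rewrite /opd.
case: pselect => // h; case: cid => -[b|x|k] /= [] // _ -> //.
Qed.

End Compilation.

(** * Mesh geometry *)

Section Mesh.
Context (N : nat).

Definition mkcell l (a : bool) (p t : 'I_(N %/ 2 ^ l)) : cell N l :=
  if a then (t, p) else (p, t).

Lemma pos_mkcell l a p t : pos (@mkcell l a p t) a = p.
Proof. by rewrite /pos /mkcell; case: a. Qed.

Lemma pos_mkcellN l a p t : pos (@mkcell l a p t) (~~ a) = t.
Proof. by rewrite /pos /mkcell; case: a. Qed.

Lemma pos_inj l (a : bool) (C C' : cell N l) :
  pos C a = pos C' a -> pos C (~~ a) = pos C' (~~ a) -> C = C'.
Proof.
by case: C C' => [c1 c2] [c1' c2']; case: a => /= h1 h2; congr (_, _); apply: val_inj.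
Qed.

Lemma pos_lt l (C : cell N l) a : (pos C a < N %/ 2 ^ l)%N.
Proof. by rewrite /pos; case: a. Qed.

Lemma coarse_lt l m n : (2 ^ (l + n) %| N -> m < N %/ 2 ^ l -> m %/ 2 ^ n < N %/ 2 ^ (l + n))%N.
Proof.
move=> /dvdnP [q ->]; rewrite mulnK ?expn_gt0 // expnD.
rewrite [(2 ^ l * _)%N]mulnC mulnA mulnK ?expn_gt0 //.
by rewrite ltn_divLR ?expn_gt0.
Qed.

(** Mostly used from level 0, where [0 + n] reduces to [n] and the result has the type of level-n
    cells without a cast. *)
Definition ancestor l n (h : (2 ^ (l + n) %| N)%N) (C : cell N l) : cell N (l + n) :=
  (Ordinal (coarse_lt h (ltn_ord C.1)), Ordinal (coarse_lt h (ltn_ord C.2))).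

Lemma pos_ancestor l n (h : (2 ^ (l + n) %| N)%N) (C : cell N l) a :
  pos (ancestor h C) a = (pos C a %/ 2 ^ n)%N.
Proof. by case: a. Qed.

Lemma subcellE l (h : (2 ^ l %| N)%N) (C0 : cell N 0) (C : cell N l) :
  subcell C0 C = (@ancestor 0 l h C0 == C).
Proof.
by case: C => c1 c2; rewrite /subcell /ancestor xpair_eqE -!val_eqE.
Qed.

Lemma on_side_unique l (C : cell N l) s s' i :
  on_side C s i -> on_side C s' i -> s = s'.
Proof.
case: s s' => [a b] [a' b'] /and3P[/eqP /= ea /eqP eb _] /and3P[/eqP /= ea' /eqP eb' _].
subst a; subst a'; congr (_, _); move: eb'; rewrite eb => /eqP.
by rewrite eqn_mul2r expn_eq0 /= eqn_add2l => /eqP {eb}; case: b b' => -[].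
Qed.

Lemma on_side_cell l (C C' : cell N l) s i :
  on_side C s i -> on_side C' s i -> C = C'.
Proof.
case: s => [a b] /and3P[_ /eqP /= ea et] /and3P[_ /eqP /= ea' et'].
apply: (@pos_inj _ a).
  by move: ea'; rewrite ea => /eqP; rewrite eqn_mul2r expn_eq0 /= eqn_add2r => /eqP.
have p0 : (0 < 2 ^ l)%N by rewrite expn_gt0.
move: et et'; set c := pos _ _; set c' := pos _ _ => /andP[h1 h2] /andP[h1' h2'].
apply/eqP; rewrite eqn_leq; apply/andP; split; rewrite -ltnS -(ltn_pmul2r p0).
  exact: leq_ltn_trans h1 h2'.
exact: leq_ltn_trans h1' h2.
Qed.

Lemma on_side_ancestor l (h : (2 ^ l %| N)%N) (C0 : cell N 0) s i :
  (2 ^ l %| epos i)%N -> on_side C0 s i -> on_side (@ancestor 0 l h C0) s i.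
Proof.
have p0 : (0 < 2 ^ l)%N by rewrite expn_gt0.
move=> hi /and3P[ea /eqP ep]; rewrite expn0 !muln1 in ep *; move=> et.
have {et} et : etan i = pos C0 (~~ s.1) by apply/eqP; lia.
apply/and3P; split => //; rewrite !pos_ancestor.
  move: hi; rewrite ep; case: s.2 => /= /dvdnP [q hq].
    case: q hq => [|q hq]; first by rewrite addn1.
    (* On an upper side, one plus the position of [C0] is the multiple (q + 1) 2^l, so [C0] is the
       last cell of its row inside the ancestor, whose position is q. *)
    have -> : pos C0 s.1 = (q * 2 ^ l + (2 ^ l).-1)%N.
      by move: hq; rewrite mulSn; move: (2 ^ l)%N p0 => e; lia.
    rewrite divnMDl // divn_small ?prednK // addn0.
    by rewrite add0n mulnDl; move: (2 ^ l)%N p0 => e; lia.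
  by move: hq; rewrite addn0 => ->; rewrite mulnK // !addn0.
by rewrite et add0n leq_trunc_div /= -ltn_divLR.
Qed.

Lemma on_side_subcell l (C : cell N l) s i : on_side C s i ->
  exists2 C0 : cell N 0, subcell C0 C & on_side C0 s i.
Proof.
have p0 : (0 < 2 ^ l)%N by rewrite expn_gt0.
case: s => a b /and3P[/= ea /eqP ep /andP[et1 et2]].
have bd c : (c < N %/ 2 ^ l -> c.+1 * 2 ^ l <= N)%N.
  by move=> hc; rewrite (leq_trans _ (leq_trunc_div N (2 ^ l))) // leq_mul2r hc orbT.
have hp : (epos i - b < N %/ 2 ^ 0)%N.
  have := bd _ (pos_lt C a); rewrite expn0 divn1 ep mulnDl; case: b {ep} => /=; rewrite ?mulSn; lia.
have ht : (etan i < N %/ 2 ^ 0)%N by rewrite expn0 divn1 /etan.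
pose C0 := mkcell a (Ordinal hp) (Ordinal ht).
have hb : (b <= epos i)%N.
  by rewrite ep mulnDl; case: b {ep hp C0} => //=; lia.
have e1 : (pos C0 a %/ 2 ^ l = pos C a)%N.
  rewrite pos_mkcell /= ep mulnDl; case: b {ep hp C0 hb} => /=.
    rewrite mul1n -addnBA // divnMDl // divn_small ?addn0 //; lia.
  by rewrite addn0 subn0 mulnK.
have e2 : (pos C0 (~~ a) %/ 2 ^ l = pos C (~~ a))%N.
  rewrite pos_mkcellN /=; apply/eqP; rewrite eqn_leq -ltnS ltn_divLR // et2 /=.
  by rewrite leq_divRL.
exists C0.
  have sub (D : cell N 0) : (pos D a %/ 2 ^ l = pos C a)%N ->
      (pos D (~~ a) %/ 2 ^ l = pos C (~~ a))%N -> subcell D C.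
    by clear; rewrite /subcell /pos; case: a => /= -> ->; rewrite !eqxx.
  exact: sub.
apply/and3P; split => //=; rewrite ?pos_mkcell ?pos_mkcellN /= expn0 !muln1 ?leqnn ?ltnSn //.
by rewrite subnK.
Qed.

Lemma on_bd_subcell l (C : cell N l) i : on_bd C i ->
  exists2 C0 : cell N 0, subcell C0 C & on_bd C0 i.
Proof.
move=> /existsP[s /on_side_subcell[C0 h1 h2]]; exists C0 => //.
by apply/existsP; exists s.
Qed.

Lemma on_bd_ancestor l (h : (2 ^ l %| N)%N) (C0 : cell N 0) i :
  (2 ^ l %| epos i)%N -> on_bd C0 i -> on_bd (@ancestor 0 l h C0) i.
Proof.
by move=> hi /existsP[s hs]; apply/existsP; exists s; apply: on_side_ancestor.
Qed.

Lemma on_bd_epos l (C : cell N l) i : on_bd C i -> (2 ^ l %| epos i)%N.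
Proof. by move=> /existsP[s /and3P[_ /eqP -> _]]; apply: dvdn_mull. Qed.

Lemma edge_neighbour (i : edge N) : exists C0 : cell N 0, on_bd C0 i.
Proof.
have N0 : (0 < N)%N by case: i => -[_ _] [t]; case: N t.
have ht : (etan i < N %/ 2 ^ 0)%N by rewrite expn0 divn1 /etan.
(* The cell just above the edge, except on the last mesh line, where only the cell below exists. *)
have hp : (epos i - (epos i == N) < N %/ 2 ^ 0)%N.
  rewrite expn0 divn1; have : (epos i <= N)%N by rewrite -ltnS /epos.
  by case: eqP => /=; lia.
exists (mkcell (eaxis i) (Ordinal hp) (Ordinal ht)); apply/existsP.
exists (eaxis i, epos i == N); apply/and3P; split => //=.
  by rewrite pos_mkcell /= expn0 muln1 subnK //; case: eqP => // ->.
by rewrite pos_mkcellN /= expn0 !muln1 leqnn ltnSn.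
Qed.

Lemma skelE l (h : (2 ^ l %| N)%N) (i : edge N) : (i \in skel N l) = (2 ^ l %| epos i)%N.
Proof.
rewrite inE; apply/existsP/idP => [[C]|hi]; first exact: on_bd_epos.
have [C0 hC] := edge_neighbour i; exists (@ancestor 0 l h C0).
exact: on_bd_ancestor.
Qed.

(** Both subcells touch the edge from the same side, namely the one on which [C] does. This makes
    one-sided values on the skeleton one-term sums. *)
Lemma on_bd_subcell_unique l (h : (2 ^ l %| N)%N) (C : cell N l) (C0 C1 : cell N 0) i :
  (2 ^ l %| epos i)%N -> subcell C0 C -> subcell C1 C -> on_bd C0 i -> on_bd C1 i ->
  C0 = C1.
Proof.
move=> hi; rewrite !(subcellE h) => /eqP e0 /eqP e1 /existsP[s hs] /existsP[s' hs'].
have := on_side_ancestor h hi hs; rewrite e0 => /on_side_unique.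
have := on_side_ancestor h hi hs'; rewrite e1 => h1 /(_ _ h1) ss'.
by rewrite -ss' in hs'; apply: on_side_cell hs hs'.
Qed.

(** An edge off the level-l mesh lines is interior to a level-l cell: passing from the lower to the
    upper neighbour crosses no multiple of 2^l. *)
Lemma same_ancestor l (h : (2 ^ l %| N)%N) (C0 C1 : cell N 0) i :
  ~~ (2 ^ l %| epos i)%N -> on_bd C0 i -> on_bd C1 i ->
  @ancestor 0 l h C0 = @ancestor 0 l h C1.
Proof.
have p0 : (0 < 2 ^ l)%N by rewrite expn_gt0.
have key (C : cell N 0) : ~~ (2 ^ l %| epos i)%N -> on_bd C i ->
    (pos C (eaxis i) %/ 2 ^ l = epos i %/ 2 ^ l)%N /\ pos C (~~ eaxis i) = etan i.
  move=> hi /existsP[[a b] /and3P[/= /eqP -> /eqP ep]]; rewrite expn0 !muln1 in ep *.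
  move=> et; split; last by apply/eqP; lia.
  case: b ep => /=; rewrite ?addn0 => ep; last by rewrite ep.
  rewrite ep addn1; rewrite ep addn1 in hi.
  have e := divn_eq (pos C a) (2 ^ l).
  have lt := ltn_pmod (pos C a) p0.
  have lt' : ((pos C a %% 2 ^ l).+1 < 2 ^ l)%N.
    rewrite ltn_neqAle lt andbT; apply: contra hi => /eqP e'.
    by rewrite e -addnS e' dvdn_addr ?dvdn_mull.
  by rewrite [in RHS]e -addnS divnMDl // [X in (_ + X)%N]divn_small ?addn0.
move=> hi h0 h1; apply: (@pos_inj _ (eaxis i)); rewrite !pos_ancestor.
  by rewrite (key _ hi h0).1 (key _ hi h1).1.
by rewrite (key _ hi h0).2 (key _ hi h1).2.
Qed.

End Mesh.

(** * Projections and function spaces *)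

Section Projection.
Context (R : realType) (N M : nat) (d : tfpm R N M) (V : selection N M).
Implicit Types (i : edge N) (k : idx M).

Lemma selE_edge_idx i k : k \in selE V i -> k \in edge_idx M i.
Proof.
move=> /bigcupP[C0 _ /bigcupP[C1 _]]; rewrite !inE => /andP[_ h].
by apply/existsP; exists C1.
Qed.

Lemma restr_sum i (X : finType) (P : pred X) (v : X -> R) (w : X -> 'cV[R]_(4 * M)) :
  restr d i (\sum_(x | P x) v x *: w x) = \sum_(x | P x) v x *: restr d i (w x).
Proof.
apply/colP => m; rewrite !mxE summxE summxE; case: ifPn => hm.
  by apply: eq_bigr => x _; rewrite !mxE hm.
by rewrite big1 // => x _; rewrite !mxE (negPf hm) mulr0.
Qed.

Lemma sum_enum_val (T : finType) (A : {set T}) (U : nmodType) (F : T -> U) :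
  \sum_(j < #|A|) F (enum_val j) = \sum_(k in A) F k.
Proof. by rewrite [RHS]big_enum_val. Qed.

Let vec_mx i (w : idx M -> 'cV[R]_(4 * M)) : 'M[R]_(#|edge_idx M i|, 4 * M) :=
  \matrix_(j, m) w (enum_val j) m 0.

Let vec_mxP i w (u : 'rV[R]_(#|edge_idx M i|)) (al : idx M -> R) :
  (forall j, u 0 j = al (enum_val j)) ->
  u *m vec_mx i w = (\sum_(k in edge_idx M i) al k *: w k)^T.
Proof.
move=> hu; apply/rowP => m; rewrite !mxE summxE.
rewrite -(sum_enum_val (edge_idx M i) (fun k => (al k *: w k) m 0)).
by apply: eq_bigr => j _; rewrite !mxE hu.
Qed.

(** For selected indices the coefficients are the triangular factor of the QR factorization; for the
    others they undo the normalization. *)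
Lemma edge_vec_chi i : edge_qr d V i -> exists T : idx M -> idx M -> R,
  {in edge_idx M i, forall k,
    edge_vec d i k = \sum_(k' in edge_idx M i) T k k' *: chi d i k'}.
Proof.
case=> _ hrest _ [rk _ [T hT]].
exists (fun k k' => if k \in selE V i then
    (if (k' \in selE V i) && (rk k' <= rk k)%N then T k' k else 0)
  else (if k' == k then `|edge_vec d i k| else 0)) => k kE.
have [ks|kns] := boolP (k \in selE V i).
  rewrite (hT k ks) big_mkcond [RHS]big_mkcond; apply: eq_bigr => k' _.
  case: ifPn => [/andP[h1 h2]|h]; last by rewrite scale0r if_same.
  by rewrite selE_edge_idx.
rewrite (bigD1 k) //= eqxx big1 ?addr0; last by move=> k' /andP[_ /negPf ->]; rewrite scale0r.
(* Freeness of the edge vectors is not assumed yet, so a zero vector has to be treated; both sides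
   are then 0. *)
rewrite hrest // scalerA; have [->|e0] := eqVneq (edge_vec d i k) 0.
  by rewrite scaler0.
by rewrite divff ?scale1r // normr_eq0.
Qed.

Context (i : edge N) (hb : edge_basis d i) (hq : edge_qr d V i).

Lemma chi_span v : exists al : idx M -> R,
  restr d i v = \sum_(k in edge_idx M i) al k *: chi d i k.
Proof.
have [al ->] := hb.1 v; have [T hT] := edge_vec_chi hq.
exists (fun k' => \sum_(k in edge_idx M i) al k * T k k').
rewrite (eq_bigr _ (fun k kE => congr1 (fun w => al k *: w) (hT k kE))).
rewrite (eq_bigr _ (fun k _ => scaler_sumr _ _ _ _)) exchange_big.
apply: eq_bigr => k' _; rewrite scaler_suml; apply: eq_bigr => k _.
by rewrite scalerA.
Qed.

(* The chi span the linearly independent family of the edge vectors, which has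
   the same cardinality. *)
Lemma chi_free (al : idx M -> R) :
  \sum_(k in edge_idx M i) al k *: chi d i k = 0 ->
  {in edge_idx M i, forall k, al k = 0}.
Proof.
have [T hT] := edge_vec_chi hq.
pose E := vec_mx i (edge_vec d i); pose C := vec_mx i (chi d i).
have freeE : row_free E.
  apply: inj_row_free => u; pose be k := \sum_j (if enum_val j == k then u 0 j else 0).
  have hu j : u 0 j = be (enum_val j).
    rewrite /be (bigD1 j) //= eqxx big1 ?addr0 // => j' jj'.
    by rewrite (inj_eq enum_val_inj) (negPf jj').
  rewrite (vec_mxP _ hu) => /(congr1 trmx); rewrite trmxK trmx0 => /(hb.2 be) be0.
  by apply/rowP => j; rewrite hu be0 ?enum_valP // mxE.
have EC : E = \matrix_(j, j') T (enum_val j) (enum_val j') *m C.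
  apply/row_matrixP => j; rewrite row_mul (@vec_mxP i (chi d i) _ (T (enum_val j))).
    by rewrite -hT ?enum_valP //; apply/rowP => m; rewrite !mxE.
  by move=> j'; rewrite !mxE.
have freeC : row_free C.
  rewrite /row_free eqn_leq rank_leq_row -{1}(eqP freeE) EC.
  exact: mxrankM_maxr.
move=> hal k kE; have := @vec_mxP i (chi d i) (\row_j al (enum_val j)) al.
rewrite hal trmx0 => /(_ _)/= h.
have u0 : \row_(j < #|edge_idx M i|) al (enum_val j) = 0.
  by apply: (row_free_inj freeC); rewrite /= mul0mx; apply: h => j; rewrite mxE.
have := congr1 (fun u : 'rV[R]_#|edge_idx M i| => u 0 (enum_rank_in kE k)) u0.
by rewrite !mxE enum_rankK_in.
Qed.

(** [proj] picks some expansion by choice. Freeness of the [chi] fixes its coefficients, though only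
    on [edge_idx M i], since the finite function is unconstrained elsewhere. *)
Lemma proj_unique v (al : idx M -> R) :
  restr d i v = \sum_(k in edge_idx M i) al k *: chi d i k ->
  {in edge_idx M i, forall k, Defs.proj d i k v = al k}.
Proof.
move=> hal k kE; rewrite /Defs.proj; set P := (X in xget _ X).
have Pal : P [ffun k => al k].
  by rewrite /P /= hal; apply: eq_bigr => k' _; rewrite ffunE.
have := xgetI (0 : {ffun idx M -> R}) Pal; rewrite {1}/P /= hal.
set be := xget _ _ => /eqP; rewrite -subr_eq0 -sumrB => /eqP h.
apply/eqP; rewrite eq_sym -subr_eq0; apply/eqP.
apply: (@chi_free (fun k => al k - be k)) => //.
by rewrite -[RHS]h; apply: eq_bigr => k' _; rewrite scalerBl.
Qed.

(** The spanning property makes the choice in [proj] succeed for every vector, and uniqueness of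
    coefficients then gives linearity. *)
Lemma proj_sum k (X : finType) (P : pred X) (v : X -> R) (w : X -> 'cV[R]_(4 * M)) :
  k \in selE V i ->
  Defs.proj d i k (\sum_(x | P x) v x *: w x) = \sum_(x | P x) v x * Defs.proj d i k (w x).
Proof.
move=> /selE_edge_idx kE.
have h u : restr d i u = \sum_(k in edge_idx M i) Defs.proj d i k u *: chi d i k.
  have [al hal] := chi_span u; rewrite hal; apply: eq_bigr => k' k'E.
  by rewrite (proj_unique hal).
apply: (@proj_unique _ (fun k => \sum_(x | P x) v x * Defs.proj d i k (w x))) => //.
rewrite restr_sum; under eq_bigr => x _ do rewrite h scaler_sumr.
rewrite exchange_big.
apply: eq_bigr => k' _; rewrite scaler_suml; apply: eq_bigr => x _.
by rewrite scalerA.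
Qed.

Lemma proj0 k : k \in selE V i -> Defs.proj d i k 0 = 0.
Proof.
move=> ks; have := @proj_sum k 'I_0 xpredT (fun=> 0) (fun=> 0) ks.
by rewrite !big_ord0.
Qed.

Lemma projN k v : k \in selE V i -> Defs.proj d i k (- v) = - Defs.proj d i k v.
Proof.
move=> ks; have := @proj_sum k 'I_1 xpredT (fun=> -1) (fun=> v) ks.
by rewrite !big_ord1 scaleN1r mulN1r.
Qed.

Lemma projD k u v : k \in selE V i ->
  Defs.proj d i k (u + v) = Defs.proj d i k u + Defs.proj d i k v.
Proof.
move=> ks; have := @proj_sum k bool xpredT (fun=> 1) (fun b => if b then u else v) ks.
by rewrite !big_bool /= !scale1r !mul1r.
Qed.

End Projection.

(** * Skeletons of consecutive levels and restriction of the data vectors *)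

Section Skeleton.
Context (N M : nat) (V : selection N M).

Lemma bnd_skel l (h : (2 ^ l %| N)%N) (i : edge N) : i \in bnd N -> i \in skel N l.
Proof. by rewrite (skelE h) inE => /orP[] /eqP ->. Qed.

Lemma inner_skel l (i : edge N) : i \in inner N l -> i \in skel N l.
Proof. by rewrite inE => /andP[]. Qed.

Lemma skelS l (h : (2 ^ l.+1 %| N)%N) (i : edge N) : i \in skel N l.+1 -> i \in skel N l.
Proof.
have hl : (2 ^ l %| 2 ^ l.+1)%N by rewrite dvdn_exp2l.
by rewrite (skelE h) (skelE (dvdn_trans hl h)); apply: dvdn_trans.
Qed.

Lemma innerS l (h : (2 ^ l.+1 %| N)%N) (i : edge N) : i \in inner N l.+1 -> i \in inner N l.
Proof. by rewrite !inE => /andP[-> /=]; have := @skelS _ h i; rewrite !inE. Qed.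

(** Boundary edges belong to every skeleton, so none disappears between levels. This reconciles the
    jumps indexing Q with those in the definition of the solution spaces. *)
Lemma skel_diffE l (h : (2 ^ l.+1 %| N)%N) :
  skel N l :\: skel N l.+1 = inner N l :\: inner N l.+1.
Proof.
apply/setP => i; rewrite !finset.in_setD; have := @bnd_skel _ h i.
by case: (i \in bnd N) => /= [->|_]; rewrite ?andbF.
Qed.

Lemma selCP l (C : cell N l) i k :
  reflect (exists2 C0 : cell N 0, subcell C0 C && on_bd C0 i & k \in V C0 /\ on_side C0 k.1 i)
    (k \in selC V C i).
Proof.
apply: (iffP bigcupP) => [[C0 h]|[C0 /andP[h _] [h1 h2]]].
  rewrite inE => /andP[h1 h2]; exists C0 => //; rewrite h; apply/existsP.
  by exists k.1.
by exists C0 => //; rewrite inE h1.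
Qed.

Lemma selC_selE l (C : cell N l) i k : k \in selC V C i -> k \in selE V i.
Proof.
move=> /selCP[C0 /andP[_ h] [h1 h2]]; apply/bigcupP; exists C0 => //.
apply/selCP; exists C0 => //; rewrite h andbT.
by apply/andP; split; apply/eqP; apply: divn1.
Qed.

(** Among the children of [D], take the one containing the level-0 neighbour of [i] inside [D]. That
    neighbour is unique at both levels, so the traces and the selected indices agree. *)
Lemma child_cell l (h : (2 ^ l.+1 %| N)%N) (D : cell N l.+1) i : on_bd D i ->
  exists C : cell N l, [/\ on_bd C i,
    forall C0 : cell N 0, subcell C0 C && on_bd C0 i = subcell C0 D && on_bd C0 i
    & selC V C i = selC V D i].
Proof.
move=> hD; have hl : (2 ^ l %| 2 ^ l.+1)%N by rewrite dvdn_exp2l.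
have h' := dvdn_trans hl h.
have [C0 sC0 bC0] := on_bd_subcell hD.
pose C : cell N l := @ancestor N 0 l h' C0; exists C.
have hi := on_bd_epos hD; have hi' := dvdn_trans hl hi.
have sC : subcell C0 C by rewrite (subcellE h').
have E C1 : subcell C1 C && on_bd C1 i = subcell C1 D && on_bd C1 i.
  have [bC1|] := boolP (on_bd C1 i); last by rewrite !andbF.
  rewrite !andbT; apply/idP/idP => h1.
    by rewrite (on_bd_subcell_unique h' hi' h1 sC bC1 bC0).
  by rewrite (on_bd_subcell_unique h hi h1 sC0 bC1 bC0).
split=> //; first exact: on_bd_ancestor.
by apply/setP => k; apply/selCP/selCP => -[C1 h1 h2]; exists C1 => //; rewrite ?E // -E.
Qed.

End Skeleton.

Section Restriction.
Context (R : realType) (N M : nat) (V : selection N M) (ori : edge N -> bool).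

(** The fine index is found independently of the data and of [f], so it can be hard-wired in the
    program. *)
Lemma dof_child l (h : (2 ^ l.+1 %| N)%N) (x : dofT V l.+1) :
  exists y : dofT V l, forall (d : tfpm R N M) f, dof d f x = dof d f y.
Proof.
case: x => [[[D i] k] /= hx]; have /andP[/= hD hk] := hx.
have [C [hC E S]] := child_cell V h hD; rewrite -S in hk.
have hy : on_bd (C, i, k).1.1 (C, i, k).1.2 &&
  ((C, i, k).2 \in selC V (C, i, k).1.1 (C, i, k).1.2) by apply/andP.
exists (exist _ (C, i, k) hy) => d f; rewrite /dof /= /Defs.trace.
by congr (Defs.proj _ _ _ _); apply: eq_bigl => C0; rewrite E.
Qed.

Lemma rhs_child l (h : (2 ^ l.+1 %| N)%N) (y : rhsT V l.+1) :
  exists y' : rhsT V l, forall (d : tfpm R N M) f,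
    Defs.rhs d ori f y = Defs.rhs d ori f y'.
Proof.
case: y => [[[[D i] k] /= hx]|[[i k] /= hx]].
  have /and3P[/= hD hi hk] := hx.
  have [C [hC E S]] := child_cell V h hD; rewrite -S in hk.
  have hy : [&& on_bd (C, i, k).1.1 (C, i, k).1.2, (C, i, k).1.2 \in bnd N &
    (C, i, k).2 \in selC V (C, i, k).1.1 (C, i, k).1.2] by apply/and3P.
  exists (inl (exist _ (C, i, k) hy)) => d f; rewrite /Defs.rhs /bdof /= /Defs.trace.
  by congr (Defs.proj _ _ _ _); apply: eq_bigl => C0; rewrite E.
have /andP[/= hi hk] := hx.
have hy : ((i, k).1 \in inner N l) && ((i, k).2 \in selE V (i, k).1).
  by rewrite /= hk (innerS h).
by exists (inr (exist _ (i, k) hy)).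
Qed.

Lemma jump_rhs l (S : {set edge N}) (hS : {subset S <= inner N l}) (z : jumpT V S) :
  exists y : rhsT V l, forall (d : tfpm R N M) f,
    jumps d ori f z = Defs.rhs d ori f y.
Proof.
case: z => [[i k] /= hx]; have /andP[/= hi hk] := hx.
have hy : ((i, k).1 \in inner N l) && ((i, k).2 \in selE V (i, k).1).
  by rewrite /= hk hS.
by exists (inr (exist _ (i, k) hy)).
Qed.

End Restriction.

(** * Linear combinations and localization in the solution spaces *)

Section Spaces.
Context (R : realType) (N M : nat) (d : tfpm R N M) (V : selection N M).
Context (ori : edge N -> bool).
Implicit Types (f : pw R N M) (i : edge N) (k : idx M).

Definition lincomb (X : finType) (v : X -> R) (F : X -> pw R N M) : pw R N M :=
  fun C z => \sum_x v x *: F x C z.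

Definition cutoff (P : pred (cell N 0)) f : pw R N M :=
  fun C z => if P C then f C z else 0.

(** The elementary quantity carried between levels; traces and jumps are sums and differences of
    these. *)
Definition edge_value f (C : cell N 0) i k : R := Defs.proj d i k (f C (midpoint R i)).

Lemma trace_lincomb (X : finType) (v : X -> R) (F : X -> pw R N M) l (C : cell N l) i :
  Defs.trace (lincomb v F) C i = \sum_x v x *: Defs.trace (F x) C i.
Proof.
rewrite /Defs.trace /lincomb exchange_big; apply: eq_bigr => x _.
by rewrite scaler_sumr.
Qed.

Lemma jump_lincomb (X : finType) (v : X -> R) (F : X -> pw R N M) i :
  Defs.jump ori (lincomb v F) i = \sum_x v x *: Defs.jump ori (F x) i.
Proof.
rewrite /Defs.jump /lincomb [X in X - _]exchange_big [X in _ - X]exchange_big.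
rewrite -sumrB scaler_sumr; apply: eq_bigr => x _.
by rewrite -!scaler_sumr -scalerBr !scalerA mulrC.
Qed.

Context (hb : forall i, edge_basis d i) (hq : forall i, edge_qr d V i).

Lemma dof_lincomb (X : finType) (v : X -> R) (F : X -> pw R N M) l (x : dofT V l) :
  dof d (lincomb v F) x = \sum_y v y * dof d (F y) x.
Proof.
rewrite /dof trace_lincomb (proj_sum (hb _) (hq _)) //.
by have /andP[_ /selC_selE] := valP x.
Qed.

Lemma jumps_lincomb (X : finType) (v : X -> R) (F : X -> pw R N M) S (x : jumpT V S) :
  jumps d ori (lincomb v F) x = \sum_y v y * jumps d ori (F y) x.
Proof.
rewrite /jumps jump_lincomb (proj_sum (hb _) (hq _)) //.
by have /andP[] := valP x.
Qed.

Lemma rhs_lincomb (X : finType) (v : X -> R) (F : X -> pw R N M) l (x : rhsT V l) :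
  Defs.rhs d ori (lincomb v F) x = \sum_y v y * Defs.rhs d ori (F y) x.
Proof.
case: x => [x|x] /=; last exact: jumps_lincomb.
rewrite /bdof trace_lincomb (proj_sum (hb _) (hq _)) //.
by have /and3P[_ _ /selC_selE] := valP x.
Qed.

Lemma trace_proj f l (C : cell N l) i k : k \in selE V i ->
  Defs.proj d i k (Defs.trace f C i) =
  \sum_(C0 : cell N 0 | subcell C0 C && on_bd C0 i) edge_value f C0 i k.
Proof.
move=> hk; have := proj_sum (hb i) (hq i) (fun C0 : cell N 0 => subcell C0 C && on_bd C0 i)
  (fun=> 1) (fun C0 => f C0 (midpoint R i)) hk.
under eq_bigr => C0 _ do rewrite scale1r.
by under [X in _ = X -> _]eq_bigr => C0 _ do rewrite mul1r.
Qed.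

Lemma jump_proj f i k : k \in selE V i ->
  Defs.proj d i k (Defs.jump ori f i) = (-1) ^+ ori i *
  (\sum_(C0 : cell N 0 | on_side C0 (eaxis i, false) i) edge_value f C0 i k
   - \sum_(C0 : cell N 0 | on_side C0 (eaxis i, true) i) edge_value f C0 i k).
Proof.
move=> hk; have hs (P : pred (cell N 0)) : Defs.proj d i k (\sum_(C0 | P C0) f C0 (midpoint R i)) =
    \sum_(C0 | P C0) edge_value f C0 i k.
  have := proj_sum (hb i) (hq i) P (fun=> 1) (fun C0 => f C0 (midpoint R i)) hk.
  under eq_bigr => C0 _ do rewrite scale1r.
  by under [X in _ = X -> _]eq_bigr => C0 _ do rewrite mul1r.
have hZ a u : Defs.proj d i k (a *: u) = a * Defs.proj d i k u.
  have := proj_sum (hb i) (hq i) (fun _ : 'I_1 => true) (fun=> a) (fun=> u) hk.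
  by rewrite !big_ord1.
by rewrite /Defs.jump hZ (projD (hb i) (hq i)) // (projN (hb i) (hq i)) // !hs.
Qed.

Lemma jump_cutoff f P i b : (forall C0 : cell N 0, on_bd C0 i -> P C0 = b) ->
  Defs.jump ori (cutoff P f) i = if b then Defs.jump ori f i else 0.
Proof.
move=> hP; have bd C0 s : on_side C0 s i -> P C0 = b.
  by move=> h; apply: hP; apply/existsP; exists s.
have E s : \sum_(C0 : cell N 0 | on_side C0 s i) cutoff P f C0 (midpoint R i) =
    if b then \sum_(C0 : cell N 0 | on_side C0 s i) f C0 (midpoint R i) else 0.
  rewrite (eq_bigr (fun C0 => if b then f C0 (midpoint R i) else 0)).
    by case: b {hP bd} => //; rewrite big1.
  by move=> C0 /bd; rewrite /cutoff => ->.
by rewrite /Defs.jump !E; case: b {hP bd E} => //; rewrite subrr scaler0.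
Qed.

Lemma Fspace_lincomb (X : finType) (v : X -> R) (F : X -> pw R N M) l :
  (forall x, Fspace d V ori l (F x)) -> Fspace d V ori l (lincomb v F).
Proof.
elim: l F => [|l IH] F hF.
  have /choice[al hal] := hF.
  exists (fun C k => \sum_x v x * al x C k) => C' z; rewrite /lincomb.
  under eq_bigr => x _ do rewrite hal scaler_sumr.
  rewrite exchange_big; apply: eq_bigr => C _.
  under eq_bigr => x _ do rewrite scaler_sumr.
  rewrite exchange_big; apply: eq_bigr => k _.
  by rewrite scaler_suml; apply: eq_bigr => x _; rewrite scalerA.
split=> [|i hi k hk]; first by apply: IH => x; have [] := hF x.
rewrite jump_lincomb (proj_sum (hb _) (hq _)) // big1 // => x _.
by have [_ /(_ i hi k hk) ->] := hF x; rewrite mulr0.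
Qed.

(** The hypothesis says that [P] does not separate the two neighbours of an edge off the level-l
    lines. Membership in F^(l) constrains jumps at such edges only, and there a cutoff keeps or
    kills both sides together. *)
Lemma Fspace_cutoff l (h : (2 ^ l %| N)%N) f P :
  (forall C0 C1 : cell N 0, forall i, ~~ (2 ^ l %| epos i)%N -> on_bd C0 i -> on_bd C1 i ->
     P C0 = P C1) ->
  Fspace d V ori l f -> Fspace d V ori l (cutoff P f).
Proof.
elim: l h f => [|l IH] h f hP.
  move=> [al hal]; exists (fun C k => if P C then al C k else 0) => C' z.
  rewrite /cutoff hal; case: ifPn => hP'.
    apply: eq_bigr => C _; apply: eq_bigr => k _; rewrite /phi.
    by case: eqP => [<-|_]; rewrite ?hP' // !scaler0.
  rewrite big1 // => C _; rewrite big1 // => k _; rewrite /phi.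
  by case: eqP => [<-|_]; rewrite ?(negPf hP') ?scale0r ?scaler0.
have hl : (2 ^ l %| 2 ^ l.+1)%N by rewrite dvdn_exp2l.
move=> [hf hj]; split.
  apply: IH => //; first exact: dvdn_trans hl h.
  move=> C0 C1 i hi; apply: hP; apply: contra hi; exact: dvdn_trans.
move=> i hi k hk; have [C0 hC0] := edge_neighbour i.
have hi' : ~~ (2 ^ l.+1 %| epos i)%N.
  by rewrite -(skelE h); move: hi; rewrite -skel_diffE // finset.in_setD => /andP[].
rewrite (@jump_cutoff f P i (P C0)).
  by case: ifP => _; [apply: hj|rewrite (proj0 (hb _) (hq _))].
by move=> C1 hC1; apply: hP hC1 hC0.
Qed.

Lemma Gspace_lincomb (X : finType) (v : X -> R) (F : X -> pw R N M) l :
  (forall x, Gspace d V ori l (F x)) -> Gspace d V ori l (lincomb v F).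
Proof.
move=> hF; split=> [|C i hi k hk]; first by apply: Fspace_lincomb => x; have [] := hF x.
rewrite trace_lincomb (proj_sum (hb _) (hq _)) ?(selC_selE hk) // big1 // => x _.
by have [_ /(_ C i hi k hk) ->] := hF x; rewrite mulr0.
Qed.

End Spaces.

(** * Dual bases and the matrices of the decomposition *)

Section Bases.
Context (R : realType) (N M : nat) (d : tfpm R N M) (V : selection N M).
Context (ori : edge N -> bool).

Definition delta (X : finType) (x y : X) : R := (y == x)%:R.

Lemma sum_delta (X : finType) (v : X -> R) y : \sum_x v x * delta x y = v y.
Proof.
rewrite (bigD1 y) //= /delta eqxx mulr1 big1 ?addr0 // => x.
by rewrite eq_sym => /negPf ->; rewrite mulr0.
Qed.

(** The default 0 makes the bases total functions of the data and of the level; the solvability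
    assumptions enter only in their specifications. *)
Definition choose_pw (P : pw R N M -> Prop) : pw R N M :=
  if pselect (exists f, P f) is left h then projT1 (cid h) else fun _ _ => 0.

Lemma choose_pwP P : (exists f, P f) -> P (choose_pw P).
Proof. by rewrite /choose_pw; case: pselect => // h _; case: cid. Qed.

Definition Fbasis l (x : dofT V l) : pw R N M :=
  choose_pw (fun f => Fspace d V ori l f /\ dof d f = delta x).

Definition Gbasis l (z : jumpT V (skel N l :\: skel N l.+1)) : pw R N M :=
  choose_pw (fun f => Gspace d V ori l f /\ jumps d ori f = delta z).

Context (hb : forall i, edge_basis d i) (hq : forall i, edge_qr d V i).
Context (L : nat) (hN : (2 ^ L %| N)%N) (hsol : unique_solvability d V ori L).
Context (hB : B_bijective d V ori L).

Lemma dvd_level l : (l <= L)%N -> (2 ^ l %| N)%N.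
Proof. by move=> hl; apply: dvdn_trans hN; rewrite dvdn_exp2l. Qed.

Lemma FbasisP l (x : dofT V l) : (l <= L)%N ->
  Fspace d V ori l (Fbasis x) /\ dof d (Fbasis x) = delta x.
Proof.
move=> hl; have [f [h _]] := hsol.1 l hl (delta x).
by apply: (@choose_pwP (fun f => Fspace d V ori l f /\ dof d f = delta x)); exists f.
Qed.

Lemma GbasisP l (z : jumpT V (skel N l :\: skel N l.+1)) : (l < L)%N ->
  Gspace d V ori l (Gbasis z) /\ jumps d ori (Gbasis z) = delta z.
Proof.
move=> hl; have [f [h _]] := hsol.2 l hl (delta z).
by apply: (@choose_pwP (fun f => Gspace d V ori l f /\ jumps d ori f = delta z)); exists f.
Qed.

Lemma Fspace_inj l f f' : (l <= L)%N -> Fspace d V ori l f -> Fspace d V ori l f' ->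
  dof (V := V) (l := l) d f = dof d f' -> f = f'.
Proof.
move=> hl hf hf' e; have [f0 [_ h]] := hsol.1 l hl (dof d f').
by rewrite -(h f) // -(h f').
Qed.

Lemma Gspace_inj l f f' : (l < L)%N -> Gspace d V ori l f -> Gspace d V ori l f' ->
  jumps (V := V) (S := skel N l :\: skel N l.+1) d ori f = jumps d ori f' -> f = f'.
Proof.
move=> hl hf hf' e; have [f0 [_ h]] := hsol.2 l hl (jumps d ori f').
by rewrite -(h f) // -(h f').
Qed.

Lemma Fspace_expand l f : (l <= L)%N -> Fspace d V ori l f ->
  f = lincomb (dof d f) (@Fbasis l).
Proof.
move=> hl hf; apply: (@Fspace_inj l) => //.
  by apply: Fspace_lincomb => // x; have [] := FbasisP x hl.
apply: funext => y; rewrite (dof_lincomb hb hq).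
under eq_bigr => x _ do rewrite (FbasisP x hl).2.
by rewrite sum_delta.
Qed.

Lemma Gspace_expand l f : (l < L)%N -> Gspace d V ori l f ->
  f = lincomb (jumps d ori f) (@Gbasis l).
Proof.
move=> hl hf; apply: (@Gspace_inj l) => //.
  by apply: Gspace_lincomb => // x; have [] := GbasisP x hl.
apply: funext => y; rewrite (jumps_lincomb ori hb hq).
under eq_bigr => x _ do rewrite (GbasisP x hl).2.
by rewrite sum_delta.
Qed.

Lemma FspaceS l f : Fspace d V ori l.+1 f -> Fspace d V ori l f.
Proof. by case. Qed.

(** Cutting the basis function off outside its cell preserves membership in F^(l) and all degrees of
    freedom, so by unique solvability the cutoff changes nothing. *)
Lemma Fbasis_local l (h : (2 ^ l %| N)%N) (x : dofT V l) (C0 : cell N 0) z : (l <= L)%N ->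
  @ancestor N 0 l h C0 != (val x).1.1 -> Fbasis x C0 z = 0.
Proof.
move=> hl hC0; pose P (C : cell N 0) := @ancestor N 0 l h C == (val x).1.1.
have hP : forall C0 C1 : cell N 0, forall i, ~~ (2 ^ l %| epos i)%N ->
    on_bd C0 i -> on_bd C1 i -> P C0 = P C1.
  by move=> C1 C2 i hi h1 h2; rewrite /P (same_ancestor h hi h1 h2).
have [hF hd] := FbasisP x hl.
suff -> : Fbasis x = cutoff P (Fbasis x) by rewrite /cutoff /P (negPf hC0).
apply: (@Fspace_inj l) => //; first exact: (Fspace_cutoff hb hq h hP).
apply: funext => y; have [/andP[hy hyk]] := (valP y).
have [xy|xy] := eqVneq (val y).1.1 (val x).1.1.
  rewrite /dof; congr (Defs.proj _ _ _ _); apply: eq_bigr => C1 /andP[hC1 _].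
  by rewrite /cutoff /P; move: hC1; rewrite (subcellE h) => /eqP ->; rewrite xy eqxx.
rewrite hd /delta; case: eqP => [e|_]; first by rewrite e eqxx in xy.
rewrite /dof /Defs.trace big1 ?(proj0 (hb _) (hq _)) ?(selC_selE hyk) //.
move=> C1 /andP[hC1 _]; rewrite /cutoff /P; move: hC1.
by rewrite (subcellE h) => /eqP ->; rewrite (negPf xy).
Qed.

Lemma matrix_of_basis T (F : T -> Prop) (X Y : finType) (x : T -> X -> R) (y : T -> Y -> R)
    (E : X -> T) :
  (forall f, F f -> forall j, y f j = \sum_i x f i * y (E i) j) ->
  matrix_of F x y (fun j i => y (E i) j).
Proof. by move=> h f /h hf j; rewrite hf; apply: eq_bigr => i _; rewrite mulrC. Qed.

Lemma is_B_basis l : (l <= L)%N ->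
  is_B d ori (fun y x => Defs.rhs d ori (@Fbasis l x) y).
Proof.
move=> hl; apply: (@matrix_of_basis _ _ _ _ _ _ (@Fbasis l)) => f hf j.
by rewrite [in LHS](Fspace_expand hl hf) (rhs_lincomb ori hb hq).
Qed.

Lemma is_P_basis l : (l < L)%N ->
  is_P d ori (fun y x => dof (V := V) (l := l) d (@Fbasis l.+1 x) y).
Proof.
move=> hl; apply: (@matrix_of_basis _ _ _ _ _ _ (@Fbasis l.+1)) => f hf j.
by rewrite [in LHS](Fspace_expand hl hf) (dof_lincomb hb hq).
Qed.

Lemma is_Q_basis l : (l < L)%N ->
  is_Q d ori (fun y z => dof (V := V) (l := l) d (@Gbasis l z) y).
Proof.
move=> hl; apply: (@matrix_of_basis _ _ _ _ _ _ (@Gbasis l)) => f hf j.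
by rewrite [in LHS](Gspace_expand hl hf) (dof_lincomb hb hq).
Qed.

(* In the basis [Fbasis] this map is block diagonal over the coarse cells, and
   its inverse is the pair of the matrices P and Q. *)
Definition coarse_data l f
    (t : dofT V l.+1 + jumpT V (skel N l :\: skel N l.+1)) : R :=
  match t with inl x => dof d f x | inr z => jumps d ori f z end.

(** The basis of F^(l) dual to [coarse_data], adapted to the splitting of F^(l) into F^(l+1) and
    G^(l+1). *)
Definition step_basis l (t : dofT V l.+1 + jumpT V (skel N l :\: skel N l.+1)) :=
  match t with inl x => Fbasis x | inr z => Gbasis z end.

Lemma coarse_data_lincomb (X : finType) (v : X -> R) (F : X -> pw R N M) l t :
  @coarse_data l (lincomb v F) t = \sum_y v y * coarse_data (F y) t.
Proof.
by case: t => t /=; [apply: (dof_lincomb hb hq)|apply: (jumps_lincomb ori hb hq)].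
Qed.

(** The mixed entries vanish by definition of the spaces: F^(l+1) has no projected jumps across the
    disappearing edges, and G^(l+1) has no degrees of freedom on the coarse cells. *)
Lemma coarse_data_step_basis l t : (l < L)%N ->
  coarse_data (@step_basis l t) = delta t.
Proof.
move=> hl; apply: funext => t'; rewrite /delta.
have [->|/eqP ne] := eqVneq t' t.
  case: t => [x|z] /=; first by rewrite (FbasisP x hl).2 /delta eqxx.
  by rewrite (GbasisP z hl).2 /delta eqxx.
case: t t' ne => [x|z] [x'|z'] ne /=.
- by rewrite (FbasisP x hl).2 /delta; case: eqP => // e; case: ne; rewrite e.
- have [[_ h] _] := FbasisP x hl; rewrite /jumps; have /andP[h1 h2] := valP z'.
  by rewrite h // -skel_diffE // dvd_level.
- have [[_ h] _] := GbasisP z hl; rewrite /dof; have /andP[h1 h2] := valP x'.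
  by rewrite h.
- by rewrite (GbasisP z hl).2 /delta; case: eqP => // e; case: ne; rewrite e.
Qed.

Lemma step_basis_Fspace l t : (l < L)%N -> Fspace d V ori l (@step_basis l t).
Proof.
move=> hl; case: t => [x|z]; first by have [[]] := FbasisP x hl.
by have [[]] := GbasisP z hl.
Qed.

(** The difference of the two sides has zero coarse data. It therefore lies in G^(l+1) with zero
    jumps, and uniqueness there makes it vanish. *)
Lemma coarse_data_expand l f : (l < L)%N -> Fspace d V ori l f ->
  f = lincomb (coarse_data f) (@step_basis l).
Proof.
move=> hl hf; set f' := lincomb _ _.
have hf' : Fspace d V ori l f'.
  by apply: Fspace_lincomb => // t; apply: step_basis_Fspace.
have e t : @coarse_data l f' t = coarse_data f t.
  rewrite coarse_data_lincomb; under eq_bigr => t' _ do rewrite coarse_data_step_basis //.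
  exact: sum_delta.
pose g := lincomb (fun b : bool => if b then 1 else -1) (fun b => if b then f else f').
have gE C z : g C z = f C z - f' C z.
  by rewrite /g /lincomb big_bool /= scale1r scaleN1r.
have eg t : @coarse_data l g t = 0.
  by rewrite coarse_data_lincomb big_bool /= e mul1r mulN1r subrr.
(* The zero function is written as an empty combination, so that the lemmas on [lincomb] give its
   membership in G^(l+1) and its jumps. *)
pose g0 : pw R N M := lincomb (fun _ : 'I_0 => 0) (fun=> f).
have g0E C z : g0 C z = 0 by rewrite /g0 /lincomb big_ord0.
have hg0 : Gspace d V ori l g0 by apply: Gspace_lincomb => // -[].
have hg : Gspace d V ori l g.
  split; first by apply: Fspace_lincomb => // -[].
  move=> C i hi k hk; have hx : on_bd (C, i, k).1.1 (C, i, k).1.2 &&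
    ((C, i, k).2 \in selC V (C, i, k).1.1 (C, i, k).1.2) by apply/andP.
  exact: (eg (inl (exist _ (C, i, k) hx))).
have g00 : g = g0.
  apply: (Gspace_inj hl hg hg0); apply: funext => z.
  by rewrite [RHS](jumps_lincomb ori hb hq) big_ord0; exact: (eg (inr z)).
apply: funext => C; apply: funext => z; apply/eqP; rewrite -subr_eq0 -gE g00.
by rewrite g0E.
Qed.

(** The two matrices are the changes of basis between [Fbasis] at level l and [step_basis]; each
    identity expands a vector of one basis in the other. *)
Lemma step_inverse l : (l < L)%N ->
  is_inverse (fun t y => coarse_data (@Fbasis l y) t)
    (fun y t => dof (V := V) (l := l) d (@step_basis l t) y).
Proof.
move=> hl; split=> [t t'|y y'].
  have := congr1 (fun f => @coarse_data l f t)
    (Fspace_expand (ltnW hl) (step_basis_Fspace t' hl)).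
  rewrite coarse_data_lincomb coarse_data_step_basis // /delta => ->.
  by apply: eq_bigr => y _; rewrite mulrC.
have [hF hd] := FbasisP y' (ltnW hl).
have := congr1 (fun f => dof (V := V) (l := l) d f y) (coarse_data_expand hl hF).
rewrite (dof_lincomb hb hq) hd /delta => ->.
by apply: eq_bigr => t _; rewrite mulrC.
Qed.

(** Solutions for unit right-hand sides; their degrees of freedom are the columns of the inverse of
    B at level L. *)
Definition rhs_basis (y : rhsT V L) : pw R N M :=
  choose_pw (fun f => Fspace d V ori L f /\ Defs.rhs d ori f = delta y).

Lemma rhs_basisP y : Fspace d V ori L (rhs_basis y) /\ Defs.rhs d ori (rhs_basis y) = delta y.
Proof.
have [v [[f [hf _ h]] _]] := hB (leqnn L) (delta y).
by apply: (@choose_pwP (fun f => Fspace d V ori L f /\ Defs.rhs d ori f = delta y)); exists f.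
Qed.

Lemma B_inverse :
  is_inverse (fun y x => Defs.rhs d ori (@Fbasis L x) y) (fun x y => dof d (rhs_basis y) x).
Proof.
split=> [y y'|x x'].
  have [hF h] := rhs_basisP y'.
  have := congr1 (fun f => Defs.rhs d ori f y) (Fspace_expand (leqnn L) hF).
  rewrite (rhs_lincomb ori hb hq) h /delta => ->.
  by apply: eq_bigr => x _; rewrite mulrC.
have [hF h] := FbasisP x' (leqnn L).
(* The solution assembled from the right-hand side of [Fbasis x'] has that same right-hand side, so
   bijectivity of B identifies the degrees of freedom. *)
pose w := Defs.rhs d ori (Fbasis x') : rhsT V L -> R.
pose f := lincomb w rhs_basis.
have hf : Fspace d V ori L f by apply: Fspace_lincomb => // y; have [] := rhs_basisP y.
have ef : Defs.rhs d ori f = w.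
  apply: funext => y; rewrite (rhs_lincomb ori hb hq).
  by under eq_bigr => y' _ do rewrite (rhs_basisP y').2; rewrite sum_delta.
have [v [_ uv]] := hB (leqnn L) w.
have e : dof d f = dof (V := V) (l := L) d (Fbasis x').
  rewrite -(uv (dof d f)); last by exists f.
  by apply: uv; exists (Fbasis x').
have := congr1 (fun u => u x) e; rewrite h (dof_lincomb hb hq) /delta => <-.
by apply: eq_bigr => y _; rewrite mulrC.
Qed.

End Bases.

(** * Counting degrees of freedom *)

Section Counting.

Lemma card_fibres (X Z : finType) (P : pred Z) (f : X -> Z) n :
  (forall z, P z -> #|[pred x | f x == z]| <= n)%N ->
  (#|[pred x | P (f x)]| <= #|P| * n)%N.
Proof.
move=> h; rewrite -[X in (X <= _)%N]sum1_card (partition_big f P) //=.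
rewrite -sum_nat_const leq_sum // => z Pz.
apply: leq_trans (h z Pz); rewrite -sum1_card; apply: eq_leq; apply: eq_bigl => x.
by rewrite !inE; case: eqP => [->|]; rewrite ?andbF // Pz.
Qed.

Lemma card_le_fibres (X Z : finType) (f : X -> Z) n :
  (forall z, #|[pred x | f x == z]| <= n)%N -> (#|X| <= #|Z| * n)%N.
Proof. by move=> h; apply: (@card_fibres X Z predT f n) => z _. Qed.

Context (N M : nat) (V : selection N M) (r : nat).

Lemma card_cell l : #|{: cell N l}| = ((N %/ 2 ^ l) ^ 2)%N.
Proof. by rewrite card_prod !card_ord mulnn. Qed.

(** An edge on the boundary of [C] is determined by its axis, by whether it is off the lower mesh
    line of [C], and by its tangential position modulo 2^l. *)
Lemma card_on_bd l (C : cell N l) : (#|[pred i : edge N | on_bd C i]| <= 4 * 2 ^ l)%N.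
Proof.
have p0 : (0 < 2 ^ l)%N by rewrite expn_gt0.
pose f (i : edge N) : side * 'I_(2 ^ l) :=
  ((eaxis i, epos i != (pos C (eaxis i) * 2 ^ l)%N), Ordinal (ltn_pmod (etan i) p0)).
have finj : {in [pred i : edge N | on_bd C i] &, injective f}.
  move=> i j; rewrite !inE => /existsP[[a b] /and3P[/= /eqP ai /eqP pi ti]].
  move=> /existsP[[a' b'] /and3P[/= /eqP aj /eqP pj tj]]; rewrite /f ai aj.
  case=> aa'; rewrite -aa' in aj pj tj *; rewrite pi pj => bb tt.
  have eb : b = b'.
    have E c : ((pos C a + nat_of_bool c) * 2 ^ l != pos C a * 2 ^ l)%N = c.
      by rewrite eqn_mul2r expn_eq0 /= -[X in (_ != X)%N]addn0 eqn_add2l; case: c.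
    by rewrite -(E b) -(E b') bb.
  have t_div k : (pos C (~~ a) * 2 ^ l <= k < (pos C (~~ a)).+1 * 2 ^ l)%N ->
      (k %/ 2 ^ l = pos C (~~ a))%N.
    move=> /andP[h1 h2]; apply/eqP; rewrite eqn_leq -ltnS ltn_divLR // h2.
    by rewrite leq_divRL.
  have ee : etan i = etan j.
    by rewrite (divn_eq (etan i) (2 ^ l)) (divn_eq (etan j) (2 ^ l)) (t_div _ ti) (t_div _ tj) tt.
  have pp : epos i = epos j by rewrite pi pj eb.
  have aij : eaxis i = eaxis j by rewrite ai aj.
  case: i j aij pp ee {ai pi ti aj pj tj tt} => -[a1 p1] t1 [[a2 p2] t2].
  rewrite /eaxis /epos /etan /= => -> e1 e2.
  by congr (_, _, _); apply: val_inj.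
rewrite -(card_in_imset finj); apply: leq_trans (max_card _) _.
by rewrite !card_prod !card_bool card_ord.
Qed.

Context (hV : forall C : cell N 0, #|V C| = (4 * r)%N).

(** There is at most one adjacent cell on each side of the edge, and it contributes at most its
    whole selection of 4r indices. *)
Lemma card_selE i : (#|selE V i| <= 8 * r)%N.
Proof.
pose W b : {set idx M} :=
  if [pick C0 : cell N 0 | on_side C0 (eaxis i, b) i] is Some C0 then V C0 else finset.set0.
have hW b : (#|W b| <= 4 * r)%N by rewrite /W; case: pickP => [C0 _|_]; rewrite ?hV ?cards0.
have sub : selE V i \subset W false :|: W true.
  apply/fintype.subsetP => k /bigcupP[C0 _ /selCP[C1 /andP[_ h1] [h2 h3]]].
  have hC1 : on_side C1 (eaxis i, k.1.2) i.
    by have /and3P[/eqP e _ _] := h3; rewrite e -surjective_pairing.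
  rewrite finset.in_setU; have : k \in W k.1.2.
    rewrite /W; case: pickP => [C2 hC2|/(_ C1)]; last by rewrite hC1.
    by rewrite -(on_side_cell hC1 hC2).
  by case: k.1.2 => ->; rewrite ?orbT.
apply: leq_trans (subset_leq_card sub) _; apply: leq_trans (leq_card_setU _ _) _.
by have := hW false; have := hW true; lia.
Qed.

(* 4 sides with 2^l edges each, and at most 4r + 4r indices selected in the two
   cells adjacent to an edge. *)
Definition bd_size l : nat := (32 * 2 ^ l * r)%N.

Definition bd_idx l (C : cell N l) : pred (edge N * idx M) :=
  [pred ik | on_bd C ik.1 && (ik.2 \in selE V ik.1)].

Lemma card_bd_idx l (C : cell N l) : (#|bd_idx C| <= bd_size l)%N.
Proof.
pose P : pred (edge N) := [pred i | on_bd C i].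
rewrite -[X in (X <= _)%N]sum1_card.
rewrite (partition_big (fun ik : edge N * idx M => ik.1) P) /=; last first.
  by move=> ik; rewrite inE => /andP[].
apply: (@leq_trans (\sum_(i | P i) (8 * r))).
  apply: leq_sum => i Pi; apply: leq_trans (card_selE i).
  rewrite sum1_card -(@card_in_imset _ _ snd); last first.
    move=> [i1 k1] [i2 k2] /andP[_ /eqP /= e1] /andP[_ /eqP /= e2] /= e.
    by rewrite e1 e2 e.
  apply: subset_leq_card; apply/fintype.subsetP => k /imsetP[[i1 k1]].
  by move=> /andP[]; rewrite inE => /andP[_ /= h] /eqP <- ->.
rewrite sum_nat_const /bd_size -[32%N]/(4 * 8)%N.
have -> : (4 * 8 * 2 ^ l * r = 4 * 2 ^ l * (8 * r))%N by lia.
rewrite leq_mul2r; apply/orP; right; apply: leq_trans (card_on_bd C).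
by apply: eq_leq; apply: eq_card.
Qed.

Lemma card_dof_cell l (C : cell N l) :
  (#|[pred x : dofT V l | (val x).1.1 == C]| <= bd_size l)%N.
Proof.
apply: leq_trans (card_bd_idx C).
rewrite -(@card_in_imset _ _ (fun x : dofT V l => ((val x).1.2, (val x).2))); last first.
  move=> [[[C1 i1] k1] h1] [[[C2 i2] k2] h2]; rewrite !inE /= => /eqP e1 /eqP e2 [e3 e4].
  by apply: val_inj; rewrite /= e1 e2 e3 e4.
apply: subset_leq_card; apply/fintype.subsetP => _ /imsetP[x hx ->].
move: hx; rewrite !inE => /eqP <-; have /andP[h1 h2] := valP x.
by rewrite h1 /= (selC_selE h2).
Qed.

Lemma card_dof l : (#|dofT V l| <= (N %/ 2 ^ l) ^ 2 * bd_size l)%N.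
Proof.
rewrite -card_cell.
exact: (@card_le_fibres _ _ (fun x : dofT V l => (val x).1.1)) (@card_dof_cell l).
Qed.

(** By locality of the basis functions, these pairs are the only possibly nonzero entries. The row
    type is abstract so that the count serves both for jumps and for edge values. *)
Lemma card_local_pairs l (T : finType) (f : T -> edge N * idx M) :
  injective f -> (forall t, (f t).2 \in selE V (f t).1) ->
  (#|[pred tx : T * dofT V l | on_bd (val tx.2).1.1 (f tx.1).1]| <=
    (N %/ 2 ^ l) ^ 2 * bd_size l * bd_size l)%N.
Proof.
move=> finj hf; set P := [pred _ | _].
have h : (#|{: {tx | P tx}}| <= #|dofT V l| * bd_size l)%N.
  apply: (@card_le_fibres _ _ (fun z : {tx | P tx} => (val z).2)) => x.
  apply: leq_trans (card_bd_idx (val x).1.1).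
  rewrite -(@card_in_imset _ _ (fun z : {tx | P tx} => f (val z).1)); last first.
    move=> [[t x1] h1] [[t' x2] h2]; rewrite !inE /= => /eqP e /eqP e' /finj e1.
    by apply: val_inj; rewrite /= e e' e1.
  apply: subset_leq_card; apply/fintype.subsetP => _ /imsetP[z hz ->].
  move: hz; rewrite !inE => /eqP <-; rewrite hf andbT.
  exact: (valP z).
rewrite card_sig in h; apply: leq_trans h _.
by rewrite leq_mul2r card_dof orbT.
Qed.

Lemma parent_lt l m : (2 ^ l.+1 %| N -> m < N %/ 2 ^ l -> m %/ 2 < N %/ 2 ^ l.+1)%N.
Proof. by have := @coarse_lt N l m 1; rewrite addn1 expn1. Qed.

(** Separate from [ancestor], because [l + 1] does not reduce to [l.+1]. *)
Definition parent l (h : (2 ^ l.+1 %| N)%N) (C : cell N l) : cell N l.+1 :=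
  (Ordinal (parent_lt h (ltn_ord C.1)), Ordinal (parent_lt h (ltn_ord C.2))).

Lemma parent_ancestor l (h : (2 ^ l.+1 %| N)%N) (h' : (2 ^ l %| N)%N) (C0 : cell N 0) :
  parent h (@ancestor N 0 l h' C0) = @ancestor N 0 l.+1 h C0.
Proof. by congr (_, _); apply: val_inj; rewrite /= -divnMA -expnSr. Qed.

(** The parities of the two coordinates distinguish the children of [D]. *)
Lemma card_children l (h : (2 ^ l.+1 %| N)%N) (D : cell N l.+1) :
  (#|[pred C : cell N l | parent h C == D]| <= 4)%N.
Proof.
pose f (C : cell N l) := (odd C.1, odd C.2).
rewrite -(@card_in_imset _ _ f).
  by apply: leq_trans (max_card _) _; rewrite card_prod card_bool.
move=> [c1 c2] [c1' c2']; rewrite !inE => /eqP <-; rewrite /parent xpair_eqE -!val_eqE /=.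
move=> /andP[/eqP e1 /eqP e2] [q1 q2]; congr (_, _); apply: val_inj => /=.
  by rewrite -(odd_double_half c1) -(odd_double_half c1') q1 -!divn2 e1.
by rewrite -(odd_double_half c2) -(odd_double_half c2') q2 -!divn2 e2.
Qed.

Lemma card_dof_children l (h : (2 ^ l.+1 %| N)%N) (D : cell N l.+1) :
  (#|[pred x : dofT V l | parent h (val x).1.1 == D]| <= 4 * bd_size l)%N.
Proof.
have := @card_fibres _ _ [pred C | parent h C == D] (fun x : dofT V l => (val x).1.1)
  (bd_size l) (fun C _ => card_dof_cell C).
by move=> /leq_trans; apply; rewrite leq_mul2r card_children orbT.
Qed.

End Counting.

(** * Cost of the levels *)

Section Stages.
Context (R : realType) (L N M r : nat) (V : selection N M) (ori : edge N -> bool).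
Context (hN : (2 ^ L %| N)%N).
Context (hV : forall C : cell N 0, #|V C| = (4 * r)%N).

Definition admissible (d : tfpm R N M) : Prop :=
  [/\ forall i, edge_basis d i, forall i, edge_qr d V i,
      unique_solvability d V ori L & B_bijective d V ori L].

Let G : Type := {d : tfpm R N M | admissible d}.
Implicit Types (K : set (G -> R)) (g : G).

Let hb g : forall i, edge_basis (sval g) i. Proof. by have [] := svalP g. Qed.
Let hq g : forall i, edge_qr (sval g) V i. Proof. by have [] := svalP g. Qed.
Let hsol g : unique_solvability (sval g) V ori L. Proof. by have [] := svalP g. Qed.

Let fb g l (x : dofT V l) : pw R N M := Fbasis (sval g) ori x.

(** The index [k] ranges over the selections of both neighbours of [i], as jumps require, and not
    only over those giving degrees of freedom of the cell. *)
Definition known_values K l : Prop :=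
  forall (x : dofT V l) (C0 : cell N 0) i k, (2 ^ l %| epos i)%N -> on_bd C0 i ->
  k \in selE V i -> K (fun g => edge_value (sval g) (fb g x) C0 i k).

Definition B_entries l : set (G -> R) :=
  [set q | exists (y : rhsT V l) x, q = fun g => Defs.rhs (sval g) ori (@fb g l x) y].
Definition P_entries l : set (G -> R) :=
  [set q | exists y x, q = fun g => dof (V := V) (l := l) (sval g) (@fb g l.+1 x) y].
Definition Q_entries l : set (G -> R) :=
  [set q | exists y z, q = fun g =>
    dof (V := V) (l := l) (sval g) (@Gbasis _ _ _ (sval g) V ori l z) y].
Definition Binv_entries : set (G -> R) :=
  [set q | exists (x : dofT V L) y, q = fun g =>
    dof (sval g) (@rhs_basis _ _ _ (sval g) V ori L y) x].

Let value0 l (h : (2 ^ l %| N)%N) g (x : dofT V l) (C0 : cell N 0) i k : (l <= L)%N ->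
  k \in selE V i -> @ancestor N 0 l h C0 != (val x).1.1 ->
  edge_value (sval g) (fb g x) C0 i k = 0.
Proof.
move=> hl hk hC; rewrite /edge_value /fb (Fbasis_local (hb g) (hq g) (hsol g) _ hl hC).
by rewrite (proj0 (hb g i) (hq g i)).
Qed.

Let known_delta K (X : finType) (x y : X) : K (fun=> 0) -> K (fun=> 1) ->
  K (fun g => delta R x y).
Proof. by rewrite /delta; case: (y == x). Qed.

Let dof_fb g l (x y : dofT V l) : (l <= L)%N -> dof (sval g) (fb g x) y = delta R x y.
Proof. by move=> hl; rewrite /fb (FbasisP (hsol g) x hl).2. Qed.

Lemma known_side_sum K l (x : dofT V l) i k s : K (fun=> 0) -> known_values K l ->
  (2 ^ l %| epos i)%N -> k \in selE V i ->
  K (fun g => \sum_(C0 : cell N 0 | on_side C0 s i) edge_value (sval g) (fb g x) C0 i k).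
Proof.
move=> K0 hK hi hk; have [[C0 hC0]|hN0] := pselect (exists C0 : cell N 0, on_side C0 s i).
  rewrite (_ : (fun _ => _) = fun g => edge_value (sval g) (fb g x) C0 i k).
    by apply: hK => //; apply/existsP; exists s.
  apply: funext => g; rewrite (bigD1 C0) //= big1 ?addr0 // => C1 /andP[h1 h2].
  by rewrite (on_side_cell h1 hC0) eqxx in h2.
rewrite (_ : (fun _ => _) = fun=> 0) //; apply: funext => g.
by rewrite big_pred0 // => C0; apply/negP => h; apply: hN0; exists C0.
Qed.

(** One subtraction per jump entry whose edge bounds the cell of the basis function; the other
    entries are 0. *)
Lemma computable_B K l : (l <= L)%N -> K (fun=> 0) -> K (fun=> 1) -> known_values K l ->
  computable K ((N %/ 2 ^ l) ^ 2 * bd_size r l * bd_size r l)%N (B_entries l).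
Proof.
move=> hl K0 K1 hK; have h := dvd_level hN hl.
pose J := (jumpT V (inner N l) * dofT V l)%type.
pose P := [pred zx : J | on_bd (val zx.2).1.1 (val zx.1).1].
pose Q (zx : J) := [set fun g => jumps (sval g) ori (fb g zx.2) zx.1].
have selz (z : jumpT V (inner N l)) : (val z).2 \in selE V (val z).1.
  by have /andP[] := valP z.
have divz (z : jumpT V (inner N l)) : (2 ^ l %| epos (val z).1)%N.
  by have /andP[/inner_skel] := valP z; rewrite skelE.
have QE zx : Q zx = [set fun g => (-1) ^+ ori (val zx.1).1 *
  (\sum_(C0 : cell N 0 | on_side C0 (eaxis (val zx.1).1, false) (val zx.1).1)
     edge_value (sval g) (fb g zx.2) C0 (val zx.1).1 (val zx.1).2
   - \sum_(C0 : cell N 0 | on_side C0 (eaxis (val zx.1).1, true) (val zx.1).1)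
     edge_value (sval g) (fb g zx.2) C0 (val zx.1).1 (val zx.1).2)].
  by congr [set _]; apply: funext => g; rewrite /jumps (jump_proj _ (hb g) (hq g)).
have cJ : computable K (#|P| * 1)%N (\bigcup_zx Q zx).
  apply: computable_family => [zx hP|zx _].
    move=> q; rewrite QE => -> /=; rewrite (_ : (fun _ => _) = fun=> 0) //.
    have sum0 g s : \sum_(C0 : cell N 0 | on_side C0 s (val zx.1).1)
        edge_value (sval g) (fb g zx.2) C0 (val zx.1).1 (val zx.1).2 = 0.
      rewrite big1 // => C0 hC0; apply: (@value0 _ h) => //.
      apply: contra hP => /eqP e; rewrite /P /= -e.
      by apply: (on_bd_ancestor h (divz _)); apply/existsP; exists s.
    by apply: funext => g; rewrite !sum0 subrr mulr0.
  have Ks s := known_side_sum zx.2 s K0 hK (divz zx.1) (selz zx.1).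
  (* The orientation is fixed with the program, so its sign is absorbed in the order of the
     operands. *)
  rewrite QE; case: (ori (val zx.1).1).
    by apply: (computable_op (o := Defs.Sub) (Ks _) (Ks _)) => g /=; rewrite expr1 mulN1r opprB.
  by apply: (computable_op (o := Defs.Sub) (Ks _) (Ks _)) => g /=; rewrite expr0 mul1r.
apply: computable_weak (computable_keep cJ) => //.
  rewrite muln1.
  by apply: (@card_local_pairs _ _ V r hV l _ val) => //; apply: val_inj.
move=> _ [[b|z] [x ->]]; last by right; exists (z, x).
(* Boundary rows are themselves degrees of freedom, hence constants 0 or 1 on the dual basis. *)
left; have /and3P[hb1 hb2 hb3] := valP b.
have hb' : on_bd (val b).1.1 (val b).1.2 && ((val b).2 \in selC V (val b).1.1 (val b).1.2).
  by rewrite hb1.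
rewrite (_ : (fun _ => _) = fun g => delta R x (exist _ (val b) hb')); first exact: known_delta.
by apply: funext => g; rewrite -(dof_fb g) // .
Qed.

(** Either neighbour will do: it serves only to file a disappearing edge under a coarse cell, and
    both neighbours have the same ancestor there. *)
Definition edge_cell (i : edge N) : cell N 0 := xchoose (edge_neighbour i).

Lemma edge_cellP i : on_bd (edge_cell i) i.
Proof. exact: (xchooseP (edge_neighbour i)). Qed.

(** A single block inversion produces both matrices: its columns indexed by coarse degrees of
    freedom form P, those indexed by jumps form Q. A block has at most [4 * bd_size r l] columns,
    coming from four children. *)
Lemma computable_PQ K l : (l < L)%N -> K (fun=> 0) -> K (fun=> 1) -> B_entries l `<=` K ->
  computable K ((N %/ 2 ^ l.+1) ^ 2 * (6 * (4 * bd_size r l) ^ 3))%N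
    (P_entries l `|` Q_entries l).
Proof.
move=> hl K0 K1 hK; have h := dvd_level hN hl; have h' := dvd_level hN (ltnW hl).
pose X := dofT V l; pose Y := (dofT V l.+1 + jumpT V (skel N l :\: skel N l.+1))%type.
pose cX (y : X) := parent h (val y).1.1.
pose cY (t : Y) := match t with
  | inl x => (val x).1.1
  | inr z => @ancestor N 0 l.+1 h (edge_cell (val z).1) end.
pose A g (t : Y) (y : X) := coarse_data (sval g) ori (fb g y) t.
pose B g (y : X) (t : Y) := dof (V := V) (l := l) (sval g) (step_basis (sval g) ori t) y.
have hAB g : is_inverse (A g) (B g) by apply: (step_inverse (hb g) (hq g) hN (hsol g) hl).
(* The matrix to invert costs nothing: its coarse rows are 0-1 constants and its jump rows are rows
   of B. *)
have KA t y : K (fun g => A g t y).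
  case: t => [x|z].
    have [x' hx'] := dof_child R h x.
    rewrite (_ : (fun _ => _) = fun g => delta R y x'); first exact: known_delta.
    by apply: funext => g; rewrite /A /= hx' dof_fb // ltnW.
  have hS : {subset skel N l :\: skel N l.+1 <= inner N l}.
    by move=> i; rewrite skel_diffE // inE => /andP[].
  have [t ht] := jump_rhs R ori hS z.
  by apply: hK; exists t, y; apply: funext => g; rewrite /A /= ht.
have A0 g t y : cY t != cX y -> A g t y = 0.
  case: t => [x|z] /= ne; rewrite /A /=.
    have /andP[hx hxk] := valP x.
    rewrite /dof (trace_proj (hb g) (hq g)) ?(selC_selE hxk) // big1 // => C0 /andP[hC0 _].
    apply: (@value0 _ h') => //; [exact: ltnW|exact: selC_selE hxk|].
    apply: contra ne => /eqP e; rewrite /cX -e parent_ancestor.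
    by rewrite eq_sym -(subcellE h).
  have /andP[hz hzk] := valP z.
  have hz' : ~~ (2 ^ l.+1 %| epos (val z).1)%N.
    by rewrite -(skelE h); move: hz; rewrite inE => /andP[].
  rewrite /jumps (jump_proj _ (hb g) (hq g)) //.
  have sum0 s : \sum_(C0 : cell N 0 | on_side C0 s (val z).1)
      edge_value (sval g) (fb g y) C0 (val z).1 (val z).2 = 0.
    rewrite big1 // => C0 hC0; apply: (@value0 _ h') => //; first exact: ltnW.
    apply: contra ne => /eqP e; rewrite /cX -e parent_ancestor; apply/eqP.
    apply: (same_ancestor h hz' (edge_cellP _)); apply/existsP; by exists s.
  by rewrite !sum0 subrr mulr0.
have := @computable_block_inverse _ _ K _ _ _ cX cY (4 * bd_size r l) A B K0 K1 KA hAB A0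
  (card_dof_children hV h).
rewrite card_cell; apply: computable_weak => // q [] [y [x ->]].
  by exists y, (inl x).
by exists y, (inr x).
Qed.

Definition value_entries l : set (G -> R) :=
  [set q | exists (x : dofT V l) (C0 : cell N 0) i k,
    [/\ (2 ^ l %| epos i)%N, on_bd C0 i, k \in selE V i
      & q = fun g => edge_value (sval g) (fb g x) C0 i k]].

(** For a given basis function and skeleton edge, at most one neighbour lies in the cell of the
    function. Only that value is paid for, the other being 0. *)
Lemma computable_values_gen K l c : (l <= L)%N -> K (fun=> 0) ->
  (forall (x : dofT V l) (C0 : cell N 0) i k, (2 ^ l %| epos i)%N -> on_bd C0 i ->
    k \in selE V i -> subcell C0 (val x).1.1 ->
    computable K c [set fun g => edge_value (sval g) (fb g x) C0 i k]) ->
  computable K ((N %/ 2 ^ l) ^ 2 * bd_size r l * bd_size r l * c)%N (value_entries l).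
Proof.
move=> hl K0 hK; have h := dvd_level hN hl.
pose T := {ik : edge N * idx M | ik.2 \in selE V ik.1}.
pose J := (T * dofT V l)%type.
pose P := [pred tx : J | on_bd (val tx.2).1.1 (val tx.1).1].
pose Q (tx : J) : set (G -> R) := [set q | exists C0 : cell N 0,
  [/\ (2 ^ l %| epos (val tx.1).1)%N, on_bd C0 (val tx.1).1
    & q = fun g => edge_value (sval g) (fb g tx.2) C0 (val tx.1).1 (val tx.1).2]].
have far (tx : J) C0 : ~~ subcell C0 (val tx.2).1.1 ->
    K (fun g => edge_value (sval g) (fb g tx.2) C0 (val tx.1).1 (val tx.1).2).
  move=> hC; rewrite (_ : (fun _ => _) = fun=> 0) //; apply: funext => g.
  by apply: (@value0 _ h) => //; apply: (valP tx.1).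
have cJ : computable K (#|P| * c)%N (\bigcup_tx Q tx).
  apply: computable_family => [tx hP|tx hP].
    move=> _ [C0 [hi hC0 ->]]; apply: far; apply: contra hP.
    by rewrite (subcellE h) => /eqP e; rewrite /P /= -e; apply: on_bd_ancestor.
  have hP' : on_bd (val tx.2).1.1 (val tx.1).1 := hP.
  have [C0 sC0 bC0] := on_bd_subcell hP'.
  have hi := on_bd_epos hP'.
  have := computable_keep (hK tx.2 C0 (val tx.1).1 (val tx.1).2 hi bC0 (valP tx.1) sC0).
  apply: computable_weak => // _ [C1 [_ bC1 ->]].
  have [sC1|nC1] := boolP (subcell C1 (val tx.2).1.1); last by left; apply: far.
  by right; rewrite (on_bd_subcell_unique h hi sC1 sC0 bC1 bC0).
apply: computable_weak cJ => //.
  rewrite leq_mul2r; apply/orP; right.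
  exact: (@card_local_pairs _ _ V r hV l T val val_inj (fun t => valP t)).
move=> _ [x [C0 [i [k [hi hC0 hk ->]]]]].
have hk' : (i, k).2 \in selE V (i, k).1 by [].
by exists ((exist _ (i, k) hk' : T), x) => //; exists C0.
Qed.

(** A basis function of level l+1 is expanded in those of level l with coefficients from P. Only the
    degrees of freedom of the four children contribute, at two operations each. *)
Lemma computable_values K l : (l < L)%N -> K (fun=> 0) -> P_entries l `<=` K ->
  known_values K l ->
  computable K ((N %/ 2 ^ l.+1) ^ 2 * bd_size r l.+1 * bd_size r l.+1 * (2 * (4 * bd_size r l)))%N
    (value_entries l.+1).
Proof.
move=> hl K0 hP hK; have h := dvd_level hN hl; have h' := dvd_level hN (ltnW hl).
apply: computable_values_gen => // x C0 i k hi bC0 hk sC0.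
have hi' : (2 ^ l %| epos i)%N by apply: dvdn_trans hi; rewrite dvdn_exp2l.
pose P := [pred y : dofT V l | parent h (val y).1.1 == (val x).1.1].
have cS := @computable_sum _ _ _ P K
  (fun y g => dof (V := V) (l := l) (sval g) (fb g x) y)
  (fun y g => edge_value (sval g) (fb g y) C0 i k) K0
  (fun y _ => hP _ (ex_intro _ y (ex_intro _ x erefl)))
  (fun y _ => hK y C0 i k hi' bC0 hk).
apply: computable_weak cS => //.
  by rewrite leq_mul2l card_dof_children // orbT.
move=> _ -> /=; apply: funext => g.
have [hF _] := FbasisP (hsol g) x hl.
rewrite {1}/fb (Fspace_expand (hb g) (hq g) (hsol g) (ltnW hl) (FspaceS hF)).
rewrite /edge_value /lincomb (proj_sum (hb g i) (hq g i)) // [in RHS]big_mkcond.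
apply: eq_bigr => y _; case: ifPn => // ne.
rewrite [X in X * _](_ : _ = 0) ?mul0r //.
have /andP[hy hyk] := valP y.
rewrite /dof (trace_proj (hb g) (hq g)) ?(selC_selE hyk) // big1 // => C1 /andP[hC1 _].
apply: (@value0 _ h) => //; first exact: selC_selE hyk.
apply: contra ne => /eqP e; rewrite /P /= -e -(parent_ancestor h h').
by move: hC1; rewrite (subcellE h') => /eqP ->.
Qed.

End Stages.

(** * The finest level, and the inverse at the coarsest one *)

Section LevelZero.
Context (R : realType) (L N M r : nat) (V : selection N M) (ori : edge N -> bool).
Context (hN : (2 ^ L %| N)%N).
Context (hV : forall C : cell N 0, #|V C| = (4 * r)%N).

Let G : Type := {d : tfpm R N M | admissible L V ori d}.
Implicit Types (K : set (G -> R)) (g : G).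

Let hb g : forall i, edge_basis (sval g) i. Proof. by have [] := svalP g. Qed.
Let hq g : forall i, edge_qr (sval g) V i. Proof. by have [] := svalP g. Qed.
Let hsol g : unique_solvability (sval g) V ori L. Proof. by have [] := svalP g. Qed.
Let hB g : B_bijective (sval g) V ori L. Proof. by have [] := svalP g. Qed.

Let fun_idx := {Ck : cell N 0 * idx M | Ck.2 \in V Ck.1}.

Let subcell0 (C0 C : cell N 0) : subcell C0 C = (C0 == C).
Proof.
by case: C0 C => [a b] [a' b']; rewrite /subcell xpair_eqE -!val_eqE /=
  [(a %/ _)%N]divn1 [(b %/ _)%N]divn1.
Qed.

Lemma trace_level0 (f : pw R N M) (C : cell N 0) i : on_bd C i ->
  Defs.trace f C i = f C (midpoint R i).
Proof.
move=> hC; rewrite /Defs.trace (big_pred1 C) // => C0.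
by rewrite subcell0 /=; case: eqP => [->|].
Qed.

(** A selected index of a cell corresponds to the degree of freedom on the edge where its basis
    function is centered. The local matrices are thus square, and a one-sided inverse suffices. *)
Lemma card_fun_idx : #|{: fun_idx}| = #|{: dofT V 0}|.
Proof.
have cell_sel (x : dofT V 0) : (val x).2 \in V (val x).1.1 /\
    on_side (val x).1.1 (val x).2.1 (val x).1.2.
  have /andP[_ /selCP[C0 /andP[hC _] [h1 h2]]] := valP x.
  by move: hC; rewrite subcell0 => /eqP <-.
pose f (x : dofT V 0) : fun_idx := exist _ ((val x).1.1, (val x).2) (cell_sel x).1.
have finj : injective f.
  move=> x y [eC ek]; apply: val_inj; have [_ sx] := cell_sel x; have [_ sy] := cell_sel y.
  move: eC ek sx sy; rewrite /=; move: (sval x) (sval y) => [[C i] k] [[C' i'] k'] /= <- <-.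
  move=> /and3P[/eqP a1 /eqP p1 t1] /and3P[/eqP a2 /eqP p2 t2]; congr (_, _, _).
  have et : etan i = etan i' by move: t1 t2; rewrite expn0 !muln1; lia.
  move: a1 p1 a2 p2 et; rewrite /eaxis /epos /etan; clear.
  case: i i' => [[a p] t] [[a' p'] t'] /= -> p1 -> p2 e.
  by congr (_, _, _); apply: val_inj => //; rewrite /= p1 p2.
apply/eqP; rewrite eqn_leq (leq_card f finj) andbT -(card_codom finj) subset_leq_card //.
apply/fintype.subsetP => -[[C k] hk] _; have lt a := pos_lt C a; rewrite expn0 divn1 in lt.
have hp : (pos C k.1.1 + k.1.2 < N.+1)%N by have := lt k.1.1; case: k.1.2 => /=; lia.
pose i : edge N := (k.1.1, Ordinal hp, Ordinal (lt (~~ k.1.1))).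
have hs : on_side C k.1 i by rewrite /on_side /= expn0 !muln1 !eqxx leqnn ltnSn.
have hbd : on_bd C i by apply/existsP; exists k.1.
have hx : on_bd (C, i, k).1.1 (C, i, k).1.2 && ((C, i, k).2 \in selC V (C, i, k).1.1 (C, i, k).1.2).
  by rewrite hbd /=; apply/selCP; exists C => //; rewrite subcell0 eqxx.
apply/codomP; exists (exist _ (C, i, k) hx).
exact: val_inj.
Qed.

Let phi_idx g (j : fun_idx) : pw R N M := phi (sval g) (val j).1 (val j).2.

Let phi_out g j C z : C != (val j).1 -> phi_idx g j C z = 0.
Proof. by rewrite /phi_idx /phi => /negPf ->. Qed.

Definition known_inputs K : Prop := forall x : inputT V, K (fun g => input (sval g) V x).

Let known_phi K (j : fun_idx) i k : K (fun=> 0) -> known_inputs K ->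
  on_bd (val j).1 i -> k \in selE V i ->
  K (fun g => edge_value (sval g) (phi_idx g j) (val j).1 i k).
Proof.
move=> K0 hK hC hk.
have hx : [&& ((val j).1, (val j).2, i, k).1.1.2 \in V ((val j).1, (val j).2, i, k).1.1.1,
   on_bd ((val j).1, (val j).2, i, k).1.1.1 ((val j).1, (val j).2, i, k).1.2 &
   ((val j).1, (val j).2, i, k).2 \in selE V ((val j).1, (val j).2, i, k).1.2].
  by rewrite /= (valP j) hC.
have := hK (exist _ ((val j).1, (val j).2, i, k) hx); congr K; apply: funext => g.
by rewrite /input /= trace_level0.
Qed.

(** Per cell, a 4r by 4r block of input values is inverted to express the dual basis in the local
    functions; each edge value is then a sum of at most 4r terms. *)
Lemma computable_values0 K : K (fun=> 0) -> K (fun=> 1) -> known_inputs K ->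
  computable K (N ^ 2 * (6 * (4 * r) ^ 3) + N ^ 2 * bd_size r 0 * bd_size r 0 * (2 * (4 * r)))%N
    (value_entries (L := L) (ori := ori) (V := V) (R := R) 0).
Proof.
move=> K0 K1 hK.
have h00 : (0 <= L)%N by [].
(* Membership in F^(0) provides coefficients for each datum; choice turns them into quantities, that
   is functions of the data. *)
have /choice[al hal] : forall gx : G * dofT V 0, exists al : cell N 0 -> idx M -> R,
    forall C z, Fbasis (sval gx.1) ori gx.2 C z =
      \sum_(C0 : cell N 0) \sum_(k in V C0) al C0 k *: phi (sval gx.1) C0 k C z.
  by case=> g x; have [[al hal] _] := FbasisP (hsol g) x h00; exists al.
pose B g (j : fun_idx) (x : dofT V 0) := al (g, x) (val j).1 (val j).2.
pose A g (x : dofT V 0) (j : fun_idx) := dof (sval g) (phi_idx g j) x.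
have fbE g x : Fbasis (sval g) ori x = lincomb (fun j => B g j x) (phi_idx g).
  apply: funext => C; apply: funext => z; rewrite (hal (g, x)) /lincomb.
  rewrite (pair_big_dep xpredT (fun (C0 : cell N 0) k => k \in V C0)
    (fun C0 k => al (g, x) C0 k *: phi (sval g) C0 k C z)) /=.
  by rewrite (big_sub [pred Ck : cell N 0 * idx M | Ck.2 \in V Ck.1]).
have hAB g : is_inverse (A g) (B g).
  apply: is_inverse_of_right; first exact: card_fun_idx.
  move=> x x'; have := congr1 (fun f => dof (sval g) f x) (fbE g x').
  rewrite (FbasisP (hsol g) x' h00).2 (dof_lincomb (hb g) (hq g)) /delta => ->.
  by apply: eq_bigr => j _; rewrite mulrC.
have A0 g x j : (val x).1.1 != (val j).1 -> A g x j = 0.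
  move=> ne; have /andP[hx hxk] := valP x.
  by rewrite /A /dof trace_level0 // phi_out // (proj0 (hb g _) (hq g _)) // (selC_selE hxk).
have KA x j : K (fun g => A g x j).
  have [e|ne] := eqVneq (val x).1.1 (val j).1; last first.
    by rewrite (_ : (fun _ => _) = fun=> 0) //; apply: funext => g; apply: A0.
  have /andP[hx hxk] := valP x.
  have hx' : on_bd (val j).1 (val x).1.2 by rewrite -e.
  have := known_phi K0 hK hx' (selC_selE hxk); congr K; apply: funext => g.
  by rewrite /A /dof trace_level0 // e.
have cB := @computable_block_inverse _ _ K _ _ (cell N 0)
  (fun j : fun_idx => (val j).1) (fun x : dofT V 0 => (val x).1.1) (4 * r) A B K0 K1 KA hAB A0.
have cardj C : (#|[pred j : fun_idx | (val j).1 == C]| <= 4 * r)%N.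
  rewrite -(hV C) -(@card_in_imset _ _ (fun j : fun_idx => (val j).2)); last first.
    move=> [[C1 k1] h1] [[C2 k2] h2]; rewrite !inE /= => /eqP e1 /eqP e2 e.
    by apply: val_inj; rewrite /= e1 e2 e.
  apply: subset_leq_card; apply/fintype.subsetP => _ /imsetP[j hj ->].
  by move: hj; rewrite !inE => /eqP <-; exact: (valP j).
have {cB} := computable_keep (cB cardj).
set K' := (X in computable _ _ X); rewrite card_cell expn0 divn1 => cB.
have KK' : K `<=` K' by move=> q; left.
have cV : computable K' ((N %/ 2 ^ 0) ^ 2 * bd_size r 0 * bd_size r 0 * (2 * (4 * r)))%N
    (value_entries (L := L) (ori := ori) (V := V) (R := R) 0).
  apply: (computable_values_gen hN hV h00) => [|x C0 i k _ bC0 hk]; first exact: KK'.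
  move=> _; pose P := [pred j : fun_idx | (val j).1 == C0].
  have KV j : P j -> K' (fun g => edge_value (sval g) (phi_idx g j) C0 i k).
    move=> /eqP e; apply: KK'; rewrite -e in bC0 *.
    exact: (known_phi K0 hK bC0 hk).
  have cS := @computable_sum _ _ _ P K' (fun j g => B g j x)
    (fun j g => edge_value (sval g) (phi_idx g j) C0 i k) (KK' _ K0)
    (fun j _ => or_intror (ex_intro _ j (ex_intro _ x erefl))) KV.
  apply: computable_weak cS => //; first by rewrite leq_mul2l cardj orbT.
  move=> _ -> /=; apply: funext => g.
  rewrite /edge_value fbE /lincomb (proj_sum (hb g i) (hq g i)) // [in RHS]big_mkcond.
  apply: eq_bigr => j _; case: ifPn => // ne.
  by rewrite phi_out 1?eq_sym // (proj0 (hb g i) (hq g i)) // mulr0.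
rewrite expn0 divn1 in cV.
exact: computable_chain KK' cB cV.
Qed.

Lemma computable_Binv K : K (fun=> 0) -> K (fun=> 1) ->
  B_entries (L := L) (ori := ori) (V := V) (R := R) L `<=` K ->
  computable K (6 * ((N %/ 2 ^ L) ^ 2 * bd_size r L) ^ 3)%N
    (Binv_entries (L := L) (ori := ori) (V := V) (R := R)).
Proof.
move=> K0 K1 hK.
have KA (y : rhsT V L) (x : dofT V L) :
    K (fun g => Defs.rhs (sval g) ori (Fbasis (sval g) ori x) y).
  by apply: hK; exists y, x.
have := computable_inverse K0 K1 KA (fun g => B_inverse (hb g) (hq g) (hsol g) (hB g)).
by apply: computable_weak => //; rewrite leq_mul2l leq_exp2r // card_dof // orbT.
Qed.

End LevelZero.

(** * Arithmetic of the cost bounds *)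

Section Cost.
Local Open Scope nat_scope.

Lemma sq_le_cube w : w ^ 2 <= w ^ 3.
Proof. by case: w => // w; rewrite leq_pexp2l. Qed.

(** Here u = 2^l, n = N / 2^(l+1) and s is the constant of [bd_size]. The coefficients 4, 384 and 32
    of B, of P with Q, and of the new values sum to 420 = 4 * 105, the 4 coming from N = 2 n u. *)
Lemma step_cost_bound s n u r : (2 * n) ^ 2 * (s * u * r) * (s * u * r) +
  (n ^ 2 * (6 * (4 * (s * u * r)) ^ 3) +
   n ^ 2 * (s * (2 * u) * r) * (s * (2 * u) * r) * (2 * (4 * (s * u * r)))) <=
  105 * s ^ 3 * (2 * n * u) ^ 2 * r ^ 3 * u.
Proof.
have -> : 105 * s ^ 3 * (2 * n * u) ^ 2 * r ^ 3 * u = 420 * (n ^ 2 * (s * u * r) ^ 3) by lia.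
have -> : n ^ 2 * (s * (2 * u) * r) * (s * (2 * u) * r) * (2 * (4 * (s * u * r))) =
  32 * (n ^ 2 * (s * u * r) ^ 3) by lia.
have -> : n ^ 2 * (6 * (4 * (s * u * r)) ^ 3) = 384 * (n ^ 2 * (s * u * r) ^ 3) by lia.
have -> : (2 * n) ^ 2 * (s * u * r) * (s * u * r) = 4 * (n ^ 2 * (s * u * r) ^ 2) by lia.
have := leq_mul (leqnn (n ^ 2)) (sq_le_cube (s * u * r)).
lia.
Qed.

(** Here u = 2^L. In the constant, 384 pays for the level-0 blocks, 9 s^2 for the level-0 values and
    B at level L, 105 s^3 for the levels below L. The last term pays for the dense inverse, of size
    n^2 s u r = s n r N, whose cube is bounded since n is at most [coarse]. *)
Lemma total_cost_bound s n u r N coarse : N = u * n -> 0 < n <= coarse ->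
  N ^ 2 * (6 * (4 * r) ^ 3) + N ^ 2 * (s * r) * (s * r) * (2 * (4 * r)) +
  105 * s ^ 3 * N ^ 2 * r ^ 3 * u +
  (n ^ 2 * (s * u * r) * (s * u * r) + 6 * (n ^ 2 * (s * u * r)) ^ 3) <=
  (384 + 9 * s ^ 2 + 105 * s ^ 3 + 6 * s ^ 3 * coarse ^ 3) * (r ^ 3 * N ^ 3).
Proof.
move=> hN /andP[n0 nc]; have uN : u <= N by rewrite hN leq_pmulr.
have -> : n ^ 2 * (s * u * r) * (s * u * r) = s ^ 2 * (N ^ 2 * r ^ 2) by rewrite hN; lia.
have -> : 6 * (n ^ 2 * (s * u * r)) ^ 3 = 6 * s ^ 3 * (n ^ 3 * (r ^ 3 * N ^ 3)) by rewrite hN; lia.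
have h1 : r ^ 3 * N ^ 2 <= r ^ 3 * N ^ 3 by rewrite leq_mul2l sq_le_cube orbT.
have h2 : N ^ 2 * r ^ 2 <= r ^ 3 * N ^ 3 by rewrite mulnC leq_mul ?sq_le_cube.
have h3 : n ^ 3 * (r ^ 3 * N ^ 3) <= coarse ^ 3 * (r ^ 3 * N ^ 3).
  by rewrite leq_mul2r leq_exp2r // nc orbT.
have h4 : N ^ 2 * r ^ 3 * u <= r ^ 3 * N ^ 3.
  by rewrite [N ^ 2 * _]mulnC -mulnA leq_mul2l [in N ^ 3]expnSr leq_mul2l uN !orbT.
have -> : N ^ 2 * (6 * (4 * r) ^ 3) = 384 * (r ^ 3 * N ^ 2) by lia.
have -> : N ^ 2 * (s * r) * (s * r) * (2 * (4 * r)) = 8 * s ^ 2 * (r ^ 3 * N ^ 2) by lia.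
have -> : 105 * s ^ 3 * N ^ 2 * r ^ 3 * u = 105 * s ^ 3 * (N ^ 2 * r ^ 3 * u) by lia.
rewrite [X in _ <= X]mulnDl [X in _ <= X + _]mulnDl [X in _ <= X + _ + _]mulnDl.
have e1 : 384 * (r ^ 3 * N ^ 2) <= 384 * (r ^ 3 * N ^ 3) by rewrite leq_mul2l h1 orbT.
have e2 : 8 * s ^ 2 * (r ^ 3 * N ^ 2) <= 8 * s ^ 2 * (r ^ 3 * N ^ 3) by rewrite leq_mul2l h1 orbT.
have e3 : 105 * s ^ 3 * (N ^ 2 * r ^ 3 * u) <= 105 * s ^ 3 * (r ^ 3 * N ^ 3).
  by rewrite leq_mul2l h4 orbT.
have e4 : s ^ 2 * (N ^ 2 * r ^ 2) <= s ^ 2 * (r ^ 3 * N ^ 3) by rewrite leq_mul2l h2 orbT.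
have e5 : 6 * s ^ 3 * (n ^ 3 * (r ^ 3 * N ^ 3)) <= 6 * s ^ 3 * coarse ^ 3 * (r ^ 3 * N ^ 3).
  by rewrite -[X in _ <= X]mulnA leq_mul2l h3 orbT.
have e6 : 9 * s ^ 2 * (r ^ 3 * N ^ 3) = 8 * s ^ 2 * (r ^ 3 * N ^ 3) + s ^ 2 * (r ^ 3 * N ^ 3).
  by rewrite -mulnDl -[X in _ = (_ + X) * _]mul1n -mulnDl.
rewrite e6; lia.
Qed.

End Cost.

(** * Assembly of the program *)

Section Assembly.
Context (R : realType) (L N M r : nat) (V : selection N M) (ori : edge N -> bool).
Context (hN : (2 ^ L %| N)%N).
Context (hV : forall C : cell N 0, #|V C| = (4 * r)%N).

Let G : Type := {d : tfpm R N M | admissible L V ori d}.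
Let base : set (G -> R) := free_quantities (fun g : G => input (sval g) V).

Let base0 : base (fun=> 0). Proof. by exists (Cst _ false). Qed.
Let base1 : base (fun=> 1). Proof. by exists (Cst _ true). Qed.
Let base_inputs : known_inputs base.
Proof. by move=> x; exists (Inp x). Qed.

Let values l : set (G -> R) := @value_entries R L N M V ori l.
Let level_entries l : set (G -> R) :=
  @B_entries R L N M V ori l `|` (@P_entries R L N M V ori l `|` @Q_entries R L N M V ori l).

Let cost0 : nat :=
  (N ^ 2 * (6 * (4 * r) ^ 3) + N ^ 2 * bd_size r 0 * bd_size r 0 * (2 * (4 * r)))%N.

Let known_of_values K l : values l `<=` K -> known_values K l.
Proof. by move=> h x C0 i k h1 h2 h3; apply: h; exists x, C0, i, k. Qed.

(** The budget is proportional to 2^l because the step from l to l+1 costs as much as is allotted to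
    all steps before it, which doubles the bound. *)
Let computable_levels s l : (forall j, bd_size r j = s * 2 ^ j * r)%N -> (l <= L)%N ->
  exists K, [/\ computable base (cost0 + 105 * s ^ 3 * N ^ 2 * r ^ 3 * 2 ^ l)%N K,
    base `<=` K, values l `<=` K & forall j, (j < l)%N -> level_entries j `<=` K].
Proof.
move=> hs; elim: l => [|l IH] hl.
  have cV := computable_keep (computable_values0 hN hV base0 base1 base_inputs).
  exists (base `|` values 0); split => //.
  by apply: computable_weak cV => //; apply: leq_addr.
have [K [cK bK vK hK]] := IH (ltnW hl).
have kK := known_of_values vK.
have cB := computable_keep (computable_B hN hV (ltnW hl) (bK _ base0) (bK _ base1) kK).
set K1 := (X in computable _ _ X) in cB.
have K1K : K `<=` K1 by move=> q; left.
have K10 : K1 (fun=> 0) by apply/K1K/bK.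
have K11 : K1 (fun=> 1) by apply/K1K/bK.
have BK1 : @B_entries R L N M V ori l `<=` K1 by move=> q; right.
have cP := computable_keep (computable_PQ hN hV hl K10 K11 BK1).
set K2 := (X in computable _ _ X) in cP.
have K2K : K1 `<=` K2 by move=> q; left.
have PK2 : @P_entries R L N M V ori l `<=` K2 by move=> q; right; left.
have vK2 : values l `<=` K2 by move=> q /vK /K1K /K2K.
have cV := computable_keep (computable_values hN hV hl (K2K _ K10) PK2 (known_of_values vK2)).
set K3 := (X in computable _ _ X) in cV.
have K3K : K2 `<=` K3 by move=> q; left.
exists K3; split.
- apply: computable_weak (computable_chain bK cK
    (computable_chain K1K cB (computable_chain K2K cP cV))) => //.
  have e2l : (2 ^ l.+1 = 2 * 2 ^ l)%N by rewrite expnS.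
  rewrite -[X in (X <= _)%N]addnA leq_add2l e2l [X in (_ <= _ * X)%N]mul2n -addnn.
  rewrite mulnDr leq_add2l !hs e2l.
  have /dvdnP[n] := dvd_level hN hl; rewrite e2l => Nn.
  have -> : (N %/ (2 * 2 ^ l) = n)%N by rewrite Nn mulnK // muln_gt0 expn_gt0.
  have -> : (N %/ 2 ^ l = 2 * n)%N by rewrite Nn mulnA mulnK ?expn_gt0 // mulnC.
  have -> : N = (2 * n * 2 ^ l)%N by rewrite Nn mulnA [(n * 2)%N]mulnC.
  exact: step_cost_bound.
- by move=> q /bK /K1K /K2K /K3K.
- by move=> q; right.
- move=> j; rewrite ltnS leq_eqVlt => /orP[/eqP ->|hj] q.
    by case=> [Bq|PQq]; apply: K3K; [apply: K2K; right|right].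
  by move=> /(hK j hj) /K1K /K2K /K3K.
Qed.

Let outputs : set (G -> R) :=
  [set q | (exists2 l, (l < L)%N & level_entries l q) \/
    @B_entries R L N M V ori L q \/ @Binv_entries R L N M V ori q].

Lemma computable_decomposition n coarse s : N = (2 ^ L * n)%N -> (0 < n <= coarse)%N ->
  (forall j, bd_size r j = s * 2 ^ j * r)%N ->
  computable base ((384 + 9 * s ^ 2 + 105 * s ^ 3 + 6 * s ^ 3 * coarse ^ 3) * (r ^ 3 * N ^ 3))%N
    outputs.
Proof.
move=> Nn hn hs; have [K [cK bK vK hK]] := computable_levels hs (leqnn L).
have cB := computable_keep (computable_B hN hV (leqnn L)
  (bK _ base0) (bK _ base1) (known_of_values vK)).
set K1 := (X in computable _ _ X) in cB.
have K1K : K `<=` K1 by move=> q; left.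
have BK1 : @B_entries R L N M V ori L `<=` K1 by move=> q; right.
have cI := computable_keep (computable_Binv hV (K1K _ (bK _ base0)) (K1K _ (bK _ base1)) BK1).
apply: computable_weak (computable_chain bK cK (computable_chain K1K cB cI)) => //.
  rewrite /cost0 !hs.
  have -> : (N %/ 2 ^ L = n)%N by rewrite Nn mulKn ?expn_gt0.
  rewrite expn0 !muln1; exact: total_cost_bound.
move=> q [[l hl hq]|[Bq|Iq]]; last by right.
  by left; apply/K1K/(hK l).
by left; apply: BK1.
Qed.

Lemma multilevel_program n coarse s : N = (2 ^ L * n)%N -> (0 < n <= coarse)%N ->
  (forall j, bd_size r j = s * 2 ^ j * r)%N ->
  exists (p : prog (inputT V)) (D : decomposition (operand (inputT V)) V L),
    (cost p <= (384 + 9 * s ^ 2 + 105 * s ^ 3 + 6 * s ^ 3 * coarse ^ 3) * (r ^ 3 * N ^ 3))%N /\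
    forall d : tfpm R N M, admissible L V ori d ->
      exists2 mem, exec (input d V) p (fun=> 0) = Some mem &
        correct_decomposition d ori (operand_val (input d V) mem) D.
Proof.
move=> Nn hn hs; have [p [opd [cp hp]]] := compile (computable_decomposition Nn hn hs).
(* The selection matrices are written as constants through these maps, which do not depend on the
   data. The value [None] is a default giving a zero row; it does not occur for l < L. *)
pose rhs_map l : rhsT V l.+1 -> option (rhsT V l) := fun y =>
  if pselect (exists y' : rhsT V l, forall (d : tfpm R N M) f,
    Defs.rhs d ori f y = Defs.rhs d ori f y')
  is left h then Some (projT1 (cid h)) else None.
pose jump_map l : jumpT V (inner N l :\: inner N l.+1) -> option (rhsT V l) := fun z =>
  if pselect (exists y' : rhsT V l, forall (d : tfpm R N M) f,
    jumps d ori f z = Defs.rhs d ori f y')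
  is left h then Some (projT1 (cid h)) else None.
pose D : decomposition (operand (inputT V)) V L := @Decomposition _ N M V L
  (fun l y x => opd (fun g => Defs.rhs (sval g) ori (Fbasis (sval g) ori x) y))
  (fun l y x => opd (fun g => dof (sval g) (Fbasis (sval g) ori x) y))
  (fun l y z => opd (fun g => dof (sval g) (Gbasis (sval g) ori z) y))
  (fun l y x => Cst _ (Some x == rhs_map l y))
  (fun l z x => Cst _ (Some x == jump_map l z))
  (fun x y => opd (fun g => dof (sval g) (rhs_basis (sval g) ori y) x)).
exists p, D; split => // d hd; pose g : G := exist _ d hd.
have [hb hq hsol hB] := hd.
have [mem [hmem hval]] := hp g; exists mem => //.
have evB l y x : (l <= L)%N -> operand_val (input d V) mem (mB D (l := l) y x) =
    Defs.rhs d ori (Fbasis d ori x) y.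
  rewrite leq_eqVlt => hl; apply: (hval (fun g => Defs.rhs (sval g) ori (Fbasis (sval g) ori x) y)).
  move: hl => /orP[/eqP e|hl]; last by left; exists l => //; left; exists y, x.
  by right; left; move: y x; rewrite e => y x; exists y, x.
have sel (X : finType) (o : option X) (v : X -> R) x0 : o = Some x0 ->
    v x0 = \sum_x (Some x == o)%:R * v x.
  move=> ->; rewrite (bigD1 x0) //= eqxx mul1r big1 ?addr0 // => x hx.
  by case: eqP => [[e]|_]; [rewrite e eqxx in hx|rewrite mul0r].
split.
- move=> l hl f hf j; rewrite (is_B_basis hb hq hsol hl hf).
  by apply: eq_bigr => x _; rewrite evB.
- move=> l hl; split=> f hf j.
    rewrite (is_P_basis hb hq hsol hl hf); apply: eq_bigr => x _; congr (_ * _).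
    symmetry; apply: (hval (fun g => dof (sval g) (Fbasis (sval g) ori x) j)).
    by left; exists l => //; right; left; exists j, x.
  rewrite (is_Q_basis hb hq hsol hl hf); apply: eq_bigr => x _; congr (_ * _).
  symmetry; apply: (hval (fun g => dof (sval g) (Gbasis (sval g) ori x) j)).
  by left; exists l => //; right; right; exists j, x.
- move=> l hl; have h := dvd_level hN hl; split=> f hf j /=.
    have : exists y' : rhsT V l, forall (d : tfpm R N M) f,
        Defs.rhs d ori f j = Defs.rhs d ori f y'.
      exact: (rhs_child R ori h j).
    have : rhs_map l j = rhs_map l j by [].
    rewrite {2}/rhs_map; case: pselect => // h1; case: cid => y' hy' e _.
    rewrite hy'; exact: sel e.
  have : exists y' : rhsT V l, forall (d : tfpm R N M) f, jumps d ori f j = Defs.rhs d ori f y'.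
    have hS : {subset inner N l :\: inner N l.+1 <= inner N l}.
      by move=> i; rewrite inE => /andP[].
    exact: (jump_rhs R ori hS j).
  have : jump_map l j = jump_map l j by [].
  rewrite {2}/jump_map; case: pselect => // h1; case: cid => y' hy' e _.
  rewrite hy'; exact: sel e.
- have [h1 h2] := B_inverse hb hq hsol hB.
  have evI x y : operand_val (input d V) mem (mBinv D x y) = dof d (rhs_basis d ori y) x.
    apply: (hval (fun g => dof (sval g) (rhs_basis (sval g) ori y) x)).
    by right; right; exists x, y.
  split=> [j j'|i i'].
    by rewrite -h1; apply: eq_bigr => x _; rewrite evB // evI.
  by rewrite -h2; apply: eq_bigr => y _; rewrite evB // evI.
Qed.

End Assembly.

Theorem lemma3p5 (R : realType) (coarse : nat) :
  exists A : nat,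
  forall (L NL N M r : nat) (V : selection N M) (ori : edge N -> bool),
    N = (2 ^ L * NL)%N -> (0 < NL <= coarse)%N -> (0 < M)%N ->
    (forall C : cell N 0, #|V C| = (4 * r)%N) ->
    (forall (C : cell N 0) (i : edge N), on_bd C i -> #|selC V C i| = r) ->
    exists (p : prog (inputT V)) (D : decomposition (operand (inputT V)) V L),
      (cost p <= A * (r ^ 3 * N ^ 3))%N /\
      forall (d : tfpm R N M) (delta : R),
        0 < delta ->
        wf_tfpm d ->
        threshold d delta = V ->
        (forall i, edge_basis d i) ->
        (forall i, edge_qr d V i) ->
        unique_solvability d V ori L ->
        B_bijective d V ori L ->
        exists2 mem, exec (input d V) p (fun=> 0) = Some mem &
          correct_decomposition d ori (operand_val (input d V) mem) D.
Proof.
(* The constant of [total_cost_bound] with s = 32, the factor in [bd_size]. *)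
exists (384 + 9 * 32 ^ 2 + 105 * 32 ^ 3 + 6 * 32 ^ 3 * coarse ^ 3)%N.
move=> L NL N M r V ori hN hNL _ hV _.
have dvdN : (2 ^ L %| N)%N by rewrite hN dvdn_mulr.
have [p [D [hp hD]]] := multilevel_program R ori dvdN hV hN hNL (fun j => erefl).
exists p, D; split; first exact: hp.
by move=> d delta _ _ _ hb hq hsol hB; apply: hD.
Qed.
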